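(* Let $n\geq 2$, let $\mathbb{K}$ be a field, $G=\mathrm{SL}(n+1,\mathbb{K})$, $A$ the adjoint $G$-module of traceless $(n+1)\times(n+1)$ matrices over $\mathbb{K}$, and let $\widehat{\varepsilon}_{\mathrm{nat}}:A_{n,\{1,n\}}(\mathbb{K})\to\mathrm{PG}(\widehat{A})$ be the relatively universal cover of the natural embedding $\varepsilon_{\mathrm{nat}}:A_{n,\{1,n\}}(\mathbb{K})\to\mathrm{PG}(A)$. Let $\Omega$ be a derivation basis of $\mathbb{K}$ and $M=\mathrm{Der}_\Omega(\mathbb{K})$. As a $G$-module, $\widehat{A}$ is the same as the $G$-module defined on $M\times A$ by the action $$g:\ (m,a)\ \longmapsto\ \Big(m+\sum_{\omega\in\Omega}\mathrm{Tr}\big(g\cdot d_\omega(g^{-1})\cdot a\big)\,d_\omega,\ g^{-1}ag\Big),\qquad g\in G,\ (m,a)\in M\times A,$$ and, up to collineations of $\mathrm{PG}(\widehat{A})$, we can always assume to have chosen the pivot of $\widehat{\varepsilon}_{\mathrm{nat}}$ in such a way that $\widehat{\varepsilon}_{\mathrm{nat}}$ acts as follows: for every point $(p,H)$ of $A_{n,\{1,n\}}(\mathbb{K})$, if $v\in V=V(n+1,\mathbb{K})$ represents $p$ and $\lambda\in V^*$ represents $H$, then $\widehat{\varepsilon}_{\mathrm{nat}}$ maps $(p,H)$ onto the point of $\mathrm{PG}(\widehat{A})$ represented by the vector $$\Big(\sum_{\omega\in\Omega}\big(v\cdot d_\omega(\lambda)\big)\,d_\omega,\ \lambda\cdot v\Big),$$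 where, for $\lambda=(\lambda_i)_{i=1}^{n+1}$ regarded as a column vector, $d_\omega(\lambda):=(d_\omega(\lambda_i))_{i=1}^{n+1}$.
   Context: Geometry: $A_{n,\{1,n\}}(\mathbb{K})$ is the point-line geometry whose points are the flags $(p,H)$ with $p$ a point and $H$ a hyperplane of $\mathrm{PG}(n,\mathbb{K})$, $p\in H$; its lines are the sets $\ell_{p,S}=\{(p,X): X \text{ a hyperplane}, X\supset S\}$ ($S$ of codimension $2$, $p\in S$) and $\ell_{L,H}=\{(x,H): x\in L\}$ ($L$ a line contained in the hyperplane $H$). Embeddings: a projective embedding of a point-line geometry $\Gamma$ is an injective map $\varepsilon$ from the points of $\Gamma$ to the points of $\mathrm{PG}(V)$, mapping every line of $\Gamma$ onto a line of $\mathrm{PG}(V)$, with image spanning $\mathrm{PG}(V)$. An embedding $\varepsilon':\Gamma\to\mathrm{PG}(V')$ covers $\varepsilon$ if there is a semilinear map $\phi:V'\to V$ (the projection) with $\varepsilon=\phi\circ\varepsilon'$; $\varepsilon'\cong\varepsilon$ if $\phi$ is bijective. Every embedding $\varepsilon$ has a relatively universal cover $\widehat{\varepsilon}$, unique up to isomorphism, which covers every embedding covering $\varepsilon$. Natural embedding: vectors of $V=V(n+1,\mathbb{K})$ are rows, those of $V^*$ are columns, so $\lambda\cdot v$ is an $(n+1)\times(n+1)$ matrix and $v\cdot\lambda$ is the scalar $\lambda(v)$. $A$ is the space of trace-$0$ matrices, with right $G$-action $a\cdot g=g^{-1}ag$; $\varepsilon_{\mathrm{nat}}$ maps $(p,H)$,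 with $p$ represented by $v$ and $H$ by $\lambda$, to the point of $\mathrm{PG}(A)$ represented by $\lambda\cdot v$. The action of $G$ on the geometry lifts through $\widehat{\varepsilon}_{\mathrm{nat}}$ to a linear action on $\widehat{A}$ inducing the given action on $A$; this makes $\widehat{A}$ a $G$-module. Pivot: a pivot for $\widehat{\varepsilon}_{\mathrm{nat}}$ is a pair of triples $\{(x_0,\ell_0,\ell_0'),(\widehat{p}_0,\widehat{L}_0,\widehat{L}_0')\}$ where $x_0$ is a point of the geometry, $\ell_0,\ell_0'$ are lines through $x_0$, one from each of the two families, $\widehat{p}_0$ is a point of $\mathrm{PG}(\widehat{A})$ and $\widehat{L}_0,\widehat{L}'_0$ are lines of $\mathrm{PG}(\widehat{A})$ through $\widehat{p}_0$ such that the projection $\widehat{A}\to A$ maps $\widehat{p}_0,\widehat{L}_0,\widehat{L}_0'$ onto $\varepsilon_{\mathrm{nat}}(x_0),\varepsilon_{\mathrm{nat}}(\ell_0),\varepsilon_{\mathrm{nat}}(\ell_0')$ respectively; given the action of $G$ on $\widehat{A}$, the embedding is recovered by transporting $\widehat{p}_0,\widehat{L}_0,\widehat{L}_0'$ by $G$. Changing the pivot amounts to composing $\widehat{\varepsilon}_{\mathrm{nat}}$ with a collineation of $\mathrm{PG}(\widehat{A})$. Derivations: $\mathrm{Der}(\mathbb{K})$ is the $\mathbb{K}$-vector space of all derivations of $\mathbb{K}$ (additive maps $d$ with $d(xy)=d(x)y+xd(y)$); $N_{\mathrm{der}}(\mathbb{K})=\{x\in\mathbb{K}: d(x)=0\ \forall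 d\in\mathrm{Der}(\mathbb{K})\}$. A derivation basis of $\mathbb{K}$ is a subset $\Omega\subseteq\mathbb{K}\setminus N_{\mathrm{der}}(\mathbb{K})$ (possibly empty) such that every map $\nu:\Omega\to\mathbb{K}$ is the restriction to $\Omega$ of a unique derivation of $\mathbb{K}$. Every field has a derivation basis. For $\omega\in\Omega$, $d_\omega$ is the derivation with $d_\omega(\omega)=1$ and $d_\omega(\omega')=0$ for $\omega'\in\Omega\setminus\{\omega\}$; $\mathrm{Der}_\Omega(\mathbb{K})$ is the subspace of $\mathrm{Der}(\mathbb{K})$ spanned by the (linearly independent) set $\{d_\omega\}_{\omega\in\Omega}$. For every $k\in\mathbb{K}$ one has $d_\omega(k)=0$ for all but finitely many $\omega$, so the sums above are finite. Derivations are applied to matrices and vectors entrywise. *)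

(* Defs.v *)
From HB Require Import structures.
From mathcomp Require Import all_boot all_order all_algebra all_fingroup.
From mathcomp Require Import all_classical.

Set Implicit Arguments.
Unset Strict Implicit.
Unset Printing Implicit Defensive.

Import GRing.Theory.
Local Open Scope classical_set_scope.
Local Open Scope ring_scope.

(* Subspaces of a possibly infinite dimensional vector space V are sets of
   vectors, and a point of PG(V) is identified with the corresponding
   1-dimensional subspace. *)
Section ProjectiveSpace.
Variables (K : fieldType) (V : lmodType K).

Definition lin_span (S : set V) : set V :=
  [set x | exists (m : nat) (c : 'I_m -> K) (y : 'I_m -> V),
     (forall i, S (y i)) /\ x = \sum_(i < m) c i *: y i].

Definition ray (v : V) : set V := [set x | exists a : K, x = a *: v].

Definition is_ppoint (P : set V) : Prop := exists2 v : V, v != 0 & P = ray v.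

Definition lin_indep2 (u v : V) : Prop :=
  forall a b : K, a *: u + b *: v = 0 -> a = 0 /\ b = 0.

Definition is_pline (L : set (set V)) : Prop :=
  exists u v : V, lin_indep2 u v /\
    L = [set P | is_ppoint P /\ P `<=` lin_span [set u; v]].

End ProjectiveSpace.

Definition is_semilinear (K : fieldType) (U V : lmodType K)
    (sigma : {rmorphism K -> K}) (f : U -> V) : Prop :=
  [/\ bijective sigma,
      forall u v, f (u + v) = f u + f v
    & forall a u, f (a *: u) = sigma a *: f u].

(* A collineation of PG(V), given by a semilinear bijection of V. *)
Definition is_collineation (K : fieldType) (V : lmodType K) (b : V -> V) : Prop :=
  bijective b /\ exists tau : {rmorphism K -> K}, is_semilinear tau b.

Record geometry := Geometry { gpoint : Type; gline : set (set gpoint) }.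

Section Embeddings.
Variables (K : fieldType) (Gamma : geometry).

Definition is_embedding (V : lmodType K) (e : gpoint Gamma -> set V) : Prop :=
  [/\ forall x, is_ppoint (e x),
      injective e,
      forall l, gline l -> is_pline (e @` l)
    & lin_span (\bigcup_(x in setT) e x) = setT].

Definition is_projection (V' V : lmodType K) (e' : gpoint Gamma -> set V')
    (e : gpoint Gamma -> set V) (sigma : {rmorphism K -> K}) (phi : V' -> V) : Prop :=
  is_semilinear sigma phi /\ forall x, e x = phi @` e' x.

Definition covers (V' V : lmodType K) (e' : gpoint Gamma -> set V')
    (e : gpoint Gamma -> set V) : Prop :=
  exists sigma phi, is_projection e' e sigma phi.

Definition is_rel_universal_cover (V' V : lmodType K)
    (e' : gpoint Gamma -> set V') (e : gpoint Gamma -> set V) : Prop :=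
  [/\ is_embedding e', covers e' e
    & forall (W : lmodType K) (e'' : gpoint Gamma -> set W),
        is_embedding e'' -> covers e'' e -> covers e' e''].

End Embeddings.

Section SpecialLinear.
Variables (n : nat) (K : fieldType).

Record SL := MkSL { SLval :> 'M[K]_n.+1; SLvalP : \det SLval == 1 }.
HB.instance Definition _ := [isSub for SLval].
HB.instance Definition _ := [Choice of SL by <:].

Fact SL_unitmx (g : SL) : (g : 'M_n.+1) \in unitmx.
Proof. by rewrite unitmxE (eqP (SLvalP g)) unitr1. Qed.

Fact SL_one_subproof : \det (1%:M : 'M[K]_n.+1) == 1.
Proof. by rewrite det1. Qed.
Fact SL_mul_subproof (g h : SL) : \det (g *m h) == 1.
Proof. by rewrite det_mulmx (eqP (SLvalP g)) (eqP (SLvalP h)) mulr1. Qed.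
Fact SL_inv_subproof (g : SL) : \det (invmx g) == 1.
Proof. by rewrite det_inv (eqP (SLvalP g)) invr1. Qed.

Definition SL_one := MkSL SL_one_subproof.
Definition SL_mul g h := MkSL (SL_mul_subproof g h).
Definition SL_inv g := MkSL (SL_inv_subproof g).

Fact SL_mulA : associative SL_mul.
Proof. by move=> f g h; apply: val_inj; rewrite /= mulmxA. Qed.
Fact SL_mul1 : left_id SL_one SL_mul.
Proof. by move=> g; apply: val_inj; rewrite /= mul1mx. Qed.
Fact SL_mulr1 : right_id SL_one SL_mul.
Proof. by move=> g; apply: val_inj; rewrite /= mulmx1. Qed.
Fact SL_mulV : left_inverse SL_one SL_inv SL_mul.
Proof. by move=> g; apply: val_inj; rewrite /= mulVmx ?SL_unitmx. Qed.
Fact SL_mulVr : right_inverse SL_one SL_inv SL_mul.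
Proof. by move=> g; apply: val_inj; rewrite /= mulmxV ?SL_unitmx. Qed.

HB.instance Definition _ :=
  isGroup.Build SL SL_mulA SL_mul1 SL_mulr1 SL_mulV SL_mulVr.

End SpecialLinear.

Definition is_Gmodule_action (K : fieldType) (G : groupType) (V : lmodType K)
    (act : V -> G -> V) : Prop :=
  [/\ forall g a u v, act (a *: u + v) g = a *: act u g + act v g,
      forall u, act u 1%g = u
    & forall u g h, act u (g * h)%g = act (act u g) h].

(* Subspaces of PG(n,K) are K-subspaces of row vectors; a hyperplane has vector
   dimension n. *)
Section FlagGeometry.
Variables (n : nat) (K : fieldType).
Local Notation V := 'rV[K]_n.+1.

Record flag := Flag {
  fpt : {vspace V};
  fhyp : {vspace V};
  flagP : [&& \dim fpt == 1%N, \dim fhyp == n & (fpt <= fhyp)%VS] }.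

Definition line_pS (p S : {vspace V}) : set flag :=
  [set x | fpt x = p /\ (S <= fhyp x)%VS].

Definition line_LH (L H : {vspace V}) : set flag :=
  [set x | (fpt x <= L)%VS /\ fhyp x = H].

Definition family1 : set (set flag) :=
  [set l | exists p S : {vspace V},
     [/\ \dim p = 1%N, (\dim S).+2 = n.+1, (p <= S)%VS & l = line_pS p S]].

Definition family2 : set (set flag) :=
  [set l | exists L H : {vspace V},
     [/\ \dim L = 2%N, \dim H = n, (L <= H)%VS & l = line_LH L H]].

Definition A1n : geometry := Geometry (family1 `|` family2).

Definition vact (U : {vspace V}) (g : SL n K) : {vspace V} :=
  (linfun (mulmxr (SLval g)) @: U)%VS.

Fact dim_vact U g : \dim (vact U g) = \dim U.
Proof.
apply: limg_dim_eq; apply/eqP; rewrite -subv0; apply/subvP => v.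
rewrite memv_cap memv_ker lfunE /= memv0 => /andP[_ /eqP vg0].
by rewrite -[v]mulmx1 -(mulmxV (SL_unitmx g)) mulmxA vg0 mul0mx.
Qed.

Fact flag_act_subproof (x : flag) (g : SL n K) :
  [&& \dim (vact (fpt x) g) == 1%N, \dim (vact (fhyp x) g) == n
    & (vact (fpt x) g <= vact (fhyp x) g)%VS].
Proof.
rewrite !dim_vact; have /and3P[-> -> le_pH] := flagP x.
exact: limgS.
Qed.

Definition flag_act (x : flag) (g : SL n K) : flag := Flag (flag_act_subproof x g).

Definition represents_point (v : V) (p : {vspace V}) : Prop :=
  v != 0 /\ p = <[v]>%VS.

Definition represents_hyp (lam : 'cV[K]_n.+1) (H : {vspace V}) : Prop :=
  lam != 0 /\ forall h : V, (h \in H) = (h *m lam == 0).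

End FlagGeometry.

Section NaturalEmbedding.
Variables (n : nat) (K : fieldType).

Definition traceless : {pred 'M[K]_n.+1} := fun a => \tr a == 0.

Fact traceless_submod_closed : submod_closed traceless.
Proof.
split=> [|c a b]; rewrite !unfold_in ?mxtrace0 // => /eqP ta /eqP tb.
by rewrite mxtraceD mxtraceZ ta tb mulr0 addr0.
Qed.
HB.instance Definition _ :=
  GRing.isSubmodClosed.Build K 'M[K]_n.+1 traceless traceless_submod_closed.

Record adjoint := Adjoint { adj_val :> 'M[K]_n.+1; adj_valP : adj_val \in traceless }.
HB.instance Definition _ := [isSub for adj_val].
HB.instance Definition _ := [Choice of adjoint by <:].
HB.instance Definition _ := [SubChoice_isSubLmodule of adjoint by <:].

Fact adj_act_subproof (a : adjoint) (g : SL n K) :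
  invmx g *m a *m g \in traceless.
Proof.
rewrite unfold_in /= mxtrace_mulC mulmxA mulmxV ?SL_unitmx // mul1mx.
exact: adj_valP.
Qed.
Definition adj_act (a : adjoint) (g : SL n K) : adjoint :=
  Adjoint (adj_act_subproof a g).

(* The matrix lam *m v has trace v *m lam, which vanishes when lam and v come
   from a flag; elsewhere the value is irrelevant. *)
Definition pure (lam : 'cV[K]_n.+1) (v : 'rV[K]_n.+1) : adjoint :=
  insubd 0 (lam *m v).

Lemma pureE lam v : v *m lam = 0 -> pure lam v = lam *m v :> 'M_n.+1.
Proof.
move=> v_lam; rewrite /pure -[LHS]/(val _) val_insubd ifT //.
by rewrite unfold_in mxtrace_mulC v_lam mxtrace0.
Qed.

Definition eps_nat (x : gpoint (A1n n K)) : set adjoint :=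
  [set a | exists v lam, [/\ represents_point v (fpt x),
                            represents_hyp lam (fhyp x) & ray (pure lam v) a]].

End NaturalEmbedding.

Section Derivations.
Variable K : fieldType.

Definition is_derivation (d : K -> K) : Prop :=
  (forall x y, d (x + y) = d x + d y) /\
  (forall x y, d (x * y) = d x * y + x * d y).

Definition Nder : set K := [set x | forall d, is_derivation d -> d x = 0].

Definition is_derivation_basis (Omega : set K) : Prop :=
  Omega `<=` ~` Nder /\
  forall nu : K -> K, exists! d : K -> K,
    is_derivation d /\ (forall w, Omega w -> d w = nu w).

Variable Omega : set K.

Definition der_at (w : K) : K -> K :=
  xget (fun=> 0) [set d | is_derivation d /\
                          forall w', Omega w' -> d w' = (w' == w)%:R].

(* As a vector space over K, functions K -> K are K -> K^o. *)
Definition derO_span : {pred (K -> K^o)} :=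
  fun d => `[< lin_span [set (der_at w : K -> K^o) | w in Omega] d >].

Fact derO_submod_closed : submod_closed derO_span.
Proof.
split=> [|k f g /asboolP[m [c [y [Sy ->]]]] /asboolP[m' [c' [y' [Sy' ->]]]]].
  apply/asboolP; exists 0%N, (fun=> 0), (fun=> 0); split; first by case.
  by rewrite big_ord0.
apply/asboolP; exists (m + m')%N.
exists (fun i => match fintype.split i with inl j => k * c j | inr j => c' j end).
exists (fun i => match fintype.split i with inl j => y j | inr j => y' j end).
split=> [i|]; first by case: (fintype.split i) => j.
rewrite big_split_ord /= scaler_sumr; congr (_ + _); apply: eq_bigr => i _.
  by rewrite (unsplitK (inl i)) scalerA.
by rewrite (unsplitK (inr i)).
Qed.
HB.instance Definition _ :=
  GRing.isSubmodClosed.Build K (K -> K^o) derO_span derO_submod_closed.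

Record DerO := MkDerO { der_val : K -> K^o; der_valP : der_val \in derO_span }.
HB.instance Definition _ := [isSub for der_val].
HB.instance Definition _ := [Choice of DerO by <:].
HB.instance Definition _ := [SubChoice_isSubLmodule of DerO by <:].

(* der_at w as an element of Der_Omega(K), for w in Omega. *)
Definition derO_elt (w : K) : DerO := insubd 0 (der_at w : K -> K^o).

Lemma derO_eltE w : Omega w -> der_val (derO_elt w) = der_at w.
Proof.
move=> Ow; rewrite /derO_elt -[LHS]/(val _) val_insubd ifT //.
apply/asboolP; exists 1%N, (fun=> 1), (fun=> der_at w); split.
  by move=> _; exists w.
by rewrite big_ord1 scale1r.
Qed.

End Derivations.

Section ExplicitModel.
Variables (n : nat) (K : fieldType) (Omega : set K).

Definition MA : lmodType K := (DerO Omega * adjoint n K)%type.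

Definition MA_act (ma : MA) (g : SL n K) : MA :=
  (ma.1 + \sum_(w \in Omega)
     \tr (g *m map_mx (der_at Omega w) (invmx g) *m ma.2) *: derO_elt Omega w,
   adj_act ma.2 g).

Definition MA_vec (v : 'rV[K]_n.+1) (lam : 'cV[K]_n.+1) : MA :=
  (\sum_(w \in Omega)
     (v *m map_mx (der_at Omega w) lam) 0 0 *: derO_elt Omega w,
   pure lam v).

End ExplicitModel.

Section Pivot.
Variables (n : nat) (K : fieldType) (Ahat : lmodType K).

Definition is_lift (ehat : gpoint (A1n n K) -> set Ahat)
    (phi : Ahat -> adjoint n K) (act : Ahat -> SL n K -> Ahat) : Prop :=
  [/\ is_Gmodule_action act,
      forall u g, phi (act u g) = adj_act (phi u) g
    & forall x g, ehat (flag_act x g) = act^~ g @` ehat x].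

Record pivot := Pivot {
  pv_x : flag n K; pv_l : set (flag n K); pv_l' : set (flag n K);
  pv_p : set Ahat; pv_L : set (set Ahat); pv_L' : set (set Ahat) }.

Definition is_pivot (phi : Ahat -> adjoint n K) (P : pivot) : Prop :=
  [/\ [/\ family1 (pv_l P), pv_l P (pv_x P),
          family2 (pv_l' P) & pv_l' P (pv_x P)],
      [/\ is_ppoint (pv_p P), is_pline (pv_L P), pv_L P (pv_p P),
          is_pline (pv_L' P) & pv_L' P (pv_p P)]
    & [/\ phi @` pv_p P = eps_nat (pv_x P),
          [set phi @` Q | Q in pv_L P] = @eps_nat n K @` pv_l P
        & [set phi @` Q | Q in pv_L' P] = @eps_nat n K @` pv_l' P]].

(* e is the embedding obtained by transporting the pivot by G; G is transitive
   on the flags, so this determines e. *)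
Definition pivot_embedding (act : Ahat -> SL n K -> Ahat) (P : pivot)
    (e : gpoint (A1n n K) -> set Ahat) : Prop :=
  forall g : SL n K,
    [/\ e (flag_act (pv_x P) g) = act^~ g @` pv_p P,
        e @` [set flag_act x g | x in pv_l P] = [set act^~ g @` Q | Q in pv_L P]
      & e @` [set flag_act x g | x in pv_l' P] = [set act^~ g @` Q | Q in pv_L' P]].

End Pivot.

(* Main.v *)
Require Import Defs.
From HB Require Import structures.
From mathcomp Require Import all_boot all_order all_algebra all_fingroup.
From mathcomp Require Import all_classical.
From mathcomp Require Import ring.

(** Above the matrix lam *m v of a flag there is exactly one vector u v lam in
    the point of PG(Ahat) attached to that flag. Because lines go onto lines, u is
    linear in each variable as long as the condition v *m lam = 0 is preserved
    ([lift_vec_bilinear]); scalars of Ahat are first twisted by the inverse of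
    sigma, so that phi becomes linear. The theorem amounts to computing the
    module generated by the values of such a map.

    An upper bound for Ahat. Let s be a linear map on matrices such that
    s (lam *m v) = u v lam for v = e_j, lam = f_i with i <> j and for
    v = e_i + e_0, lam = f_i - f_0. The map D v lam = u v lam - s (lam *m v) is
    determined by its values t_ij x = D (x e_i + e_j) (f_i - x f_j). Formally
    t_ij x is a difference of a term on axis i and a term on axis j, and such
    differences telescope along three axes, available since n >= 2 ([cocycle]).
    It follows that t_ij depends on neither i nor j and that delta = - t_ij is a
    derivation from K to Ahat, whence u v lam = s (lam *m v) + sum_i v_i delta(lam_i)
    ([flag_bilinearE]). So the kernel of phi is spanned by the values of delta.

    A lower bound. For a derivation d of K, the vectors (v d(lam), lam *m v) of
    K * A define, if d is not 0, an embedding covering the natural one. By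
    universality Ahat maps onto it. Once scalars are normalised, the first
    coordinate is a linear form ell_d on Ahat with ell_d (u v lam) = v d(lam),
    and this form vanishes on the values of s and satisfies
    ell_d (delta x) = d x ([exists_der_functional]).

    The derivation basis. A linear form on Ahat composed with delta is a
    derivation of K, which is 0 if it vanishes on Omega. As linear forms
    separate vectors from subspaces ([separating_functional]), delta maps Omega
    onto a spanning set of the kernel of phi. The forms ell_w attached to the
    derivations d_w, w in Omega, are dual to these vectors, so the latter are a
    basis of the kernel and only finitely many ell_w are nonzero on a given
    vector. Hence a |-> (sum_w ell_w(a) d_w, phi a) is an isomorphism onto M * A
    ([model_map_inj], [model_map_surj]); on the generators u v lam it has the
    required values, and there the compatibility with G is the Leibniz rule for
    vg d(g^-1 lam) ([model_map_act]). The embedding is recovered from a pivot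
    with the collineation equal to the identity ([exists_pivot]). *)

Set Implicit Arguments.
Unset Strict Implicit.
Unset Printing Implicit Defensive.

Import GRing.Theory.
Local Open Scope classical_set_scope.
Local Open Scope ring_scope.

(** * Subspaces spanned by sets of vectors *)

Section LinearSpan.
Variables (K : fieldType) (V : lmodType K).

Definition lin_closed (N : set V) : Prop :=
  N 0 /\ forall a x y, N x -> N y -> N (a *: x + y).

Lemma lin_closedZ N a x : lin_closed N -> N x -> N (a *: x).
Proof. by move=> cN Nx; rewrite -[_ *: _]addr0; apply: cN.2 => //; exact: cN.1. Qed.

Lemma lin_closedD N x y : lin_closed N -> N x -> N y -> N (x + y).
Proof. by move=> cN Nx Ny; rewrite -[x]scale1r; exact: cN.2. Qed.

Lemma lin_closedB N x y : lin_closed N -> N x -> N y -> N (x - y).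
Proof. by move=> cN Nx Ny; rewrite -scaleN1r addrC; exact: cN.2. Qed.

Lemma lin_closed_sum N (I : finType) (F : I -> V) :
  lin_closed N -> (forall i, N (F i)) -> N (\sum_i F i).
Proof.
move=> cN NF; apply: (big_ind N) => //; first exact: cN.1.
by move=> x y; exact: lin_closedD.
Qed.

Lemma lin_span_closed (S : set V) : lin_closed (lin_span S).
Proof.
split=> [|a x y [m [c [f [Sf ->]]]] [m' [c' [f' [Sf' ->]]]]].
  by exists 0%N, (fun=> 0), (fun=> 0); split=> [[]//|]; rewrite big_ord0.
exists (m + m')%N, (fun i => match fintype.split i with
                             | inl j => a * c j | inr j => c' j end),
  (fun i => match fintype.split i with inl j => f j | inr j => f' j end).
split=> [i|]; first by case: (fintype.split i) => j.
rewrite big_split_ord /= scaler_sumr; congr (_ + _); apply: eq_bigr => i _.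
  by rewrite (unsplitK (inl i)) scalerA.
by rewrite (unsplitK (inr i)).
Qed.

Lemma sub_lin_span (S : set V) : S `<=` lin_span S.
Proof.
move=> x Sx; exists 1%N, (fun=> 1), (fun=> x); split=> //.
by rewrite big_ord1 scale1r.
Qed.

Lemma lin_span_min (S N : set V) : lin_closed N -> S `<=` N -> lin_span S `<=` N.
Proof.
move=> cN SN x [m [c [f [Sf ->]]]]; apply: lin_closed_sum => // i.
by apply: lin_closedZ => //; exact/SN/Sf.
Qed.

Lemma lin_span2P (u v x : V) :
  lin_span [set u; v] x <-> exists a b, x = a *: u + b *: v.
Proof.
split=> [|[a [b ->]]]; last first.
  apply: (lin_span_closed _).2; last apply: lin_closedZ (lin_span_closed _) _.
    by apply: sub_lin_span; left.
  by apply: sub_lin_span; right.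
apply: (@lin_span_min _ [set x | exists a b, x = a *: u + b *: v]).
  split=> [|k y z [a [b ->]] [a' [b' ->]]].
    by exists 0, 0; rewrite !scale0r addr0.
  exists (k * a + a'), (k * b + b').
  by rewrite !scalerDl scalerDr !scalerA addrACA.
move=> y [->|->]; first by exists 1, 0; rewrite scale1r scale0r addr0.
by exists 0, 1; rewrite scale1r scale0r add0r.
Qed.

(** By Zorn's lemma there is a subspace N maximal among those that contain S
    and avoid x; maximality forces N to be a complement of the line of x, and
    the form sought is the coordinate along x. *)
Lemma separating_functional (S : set V) (x : V) : ~ lin_span S x ->
  exists l : {linear V -> K^o}, (forall y, S y -> l y = 0) /\ l x = 1.
Proof.
move=> Sx; pose P (N : set V) :=
  [/\ N = set0 \/ lin_span S `<=` N,
      forall a y z, N y -> N z -> N (a *: y + z) & ~ N x].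
(* The alternative N = set0 is there for the union of the empty chain. *)
have [|N [[N0 cN Nx] Nmax]] := @Zorn_bigcup V P.
  move=> F FP Ftot; split=> [|a y z [X FX Xy] [Y FY Yz]|[X /FP[_ _ Xx] /Xx]//].
    have [[X FX SX]|H] := pselect (exists2 X, F X & lin_span S `<=` X).
      by right=> y /SX Xy; exists X.
    left; apply/seteqP; split=> // y [X FX Xy].
    by have [[X0|SX] _ _] := FP X FX; [rewrite -X0|case: H; exists X].
  have [XY|YX] := Ftot X Y FX FY.
    by exists Y => //; have [_ + _] := FP Y FY; apply=> //; exact: XY.
  by exists X => //; have [_ + _] := FP X FX; apply=> //; exact: YX.
have SN : lin_span S `<=` N.
  case: N0 => // N0; case: (Nmax (lin_span S)).
    rewrite properEneq N0; split=> //; apply/eqP => /esym S0.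
    by have := (lin_span_closed S).1; rewrite S0.
  by split=> //; [right|exact: (lin_span_closed S).2].
have clN : lin_closed N by split=> //; apply: SN; exact: (lin_span_closed S).1.
have N_sub_inj c c' y : N (y - c *: x) -> N (y - c' *: x) -> c = c'.
  move=> Nc Nc'; apply: contrapT => /eqP cc'; apply: Nx.
  have := lin_closedZ (c' - c)^-1 clN (lin_closedB clN Nc Nc').
  rewrite opprB [y - _ + _]addrC subrKA -scalerBl scalerA mulVf ?scale1r //.
  by rewrite subr_eq0 eq_sym.
have N_ex y : exists c, N (y - c *: x).
  have [Ny|Ny] := pselect (N y); first by exists 0; rewrite scale0r subr0.
  pose N' := [set z | exists c, N (z - c *: y)].
  have [[c Nc]|N'x] := pselect (N' x).
    have c0 : c != 0 by apply/eqP => c0; apply: Nx; rewrite c0 scale0r subr0 in Nc.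
    exists c^-1; have := lin_closedZ (- c^-1) clN Nc.
    by rewrite scalerBr !scaleNr scalerA mulVf // scale1r opprK addrC.
  case: (Nmax N').
    split=> [z Nz|/(_ y) H]; first by exists 0; rewrite scale0r subr0.
    by apply/Ny/H; exists 1; rewrite scale1r subrr; exact: clN.1.
  split=> //; first by right=> z /SN Nz; exists 0; rewrite scale0r subr0.
  move=> a z z' [c Nc] [c' Nc']; exists (a * c + c').
  by have := cN a _ _ Nc Nc'; rewrite scalerBr scalerA scalerDl opprD addrACA.
pose l y : K^o := xget 0 [set c | N (y - c *: x)].
have lP y : N (y - l y *: x) by have [c Nc] := N_ex y; exact: (xgetPex 0 (N_ex y)).
have lin_l : linear l.
  move=> a y z; apply: (N_sub_inj _ _ (a *: y + z)) => //.
  by have := cN a _ _ (lP y) (lP z); rewrite scalerBr scalerA scalerDl opprD addrACA.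
pose L := GRing.isLinear.Build K V K^o *:%R l lin_l.
exists (HB.pack l L : {linear V -> K^o}); split=> [y Sy|] /=.
  by apply: (N_sub_inj _ _ y) => //; rewrite scale0r subr0; exact/SN/sub_lin_span.
by apply: (N_sub_inj _ _ x) => //; rewrite scale1r subrr; exact: clN.1.
Qed.

End LinearSpan.

(** * Maps that are bilinear on orthogonal pairs *)

Section FlagBilinear.
Variables (n : nat) (K : fieldType).
Local Notation row := 'rV[K]_n.+1.
Local Notation col := 'cV[K]_n.+1.

(** The shape of the function (v, lam) |-> vector above the matrix
    lam *m v of a flag: lines of the geometry vary one of v, lam while keeping
    the other one fixed, so linearity is available only inside the set of
    orthogonal pairs. *)
Definition flag_bilinear (W : lmodType K) (u : row -> col -> W) : Prop :=
  (forall lam a v w, v *m lam = 0 -> w *m lam = 0 ->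
     u (a *: v + w) lam = a *: u v lam + u w lam) /\
  (forall v a lam mu, v *m lam = 0 -> v *m mu = 0 ->
     u v (a *: lam + mu) = a *: u v lam + u v mu).

Definition er (i : 'I_n.+1) : row := delta_mx 0 i.
Definition fc (i : 'I_n.+1) : col := delta_mx i 0.

Lemma er_fc i j : er i *m fc j = if i == j then 1%:M else 0.
Proof.
rewrite mul_delta_mx_cond; case: eqP => // _.
by apply/rowP=> k; rewrite !ord1 !mxE.
Qed.

Section Rules.
Variables (W : lmodType K) (u : row -> col -> W) (ub : flag_bilinear u).

Lemma fb0l lam : u 0 lam = 0.
Proof.
have := ub.1 lam 1 0 0 (mul0mx _ _) (mul0mx _ _).
by rewrite !scale1r addr0 => /(congr1 (+%R^~ (- u 0 lam))); rewrite addrK subrr.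
Qed.

Lemma fb0r v : u v 0 = 0.
Proof.
have := ub.2 v 1 0 0 (mulmx0 _ _) (mulmx0 _ _).
by rewrite !scale1r addr0 => /(congr1 (+%R^~ (- u v 0))); rewrite addrK subrr.
Qed.

Lemma fbZl a v lam : v *m lam = 0 -> u (a *: v) lam = a *: u v lam.
Proof. by move=> o; rewrite -[a *: v]addr0 ub.1 ?mul0mx // fb0l addr0. Qed.

Lemma fbZr a v lam : v *m lam = 0 -> u v (a *: lam) = a *: u v lam.
Proof. by move=> o; rewrite -[a *: lam]addr0 ub.2 ?mulmx0 // fb0r addr0. Qed.

Lemma fbDl v w lam : v *m lam = 0 -> w *m lam = 0 ->
  u (v + w) lam = u v lam + u w lam.
Proof. by move=> o o'; rewrite -[v]scale1r ub.1 // !scale1r. Qed.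

Lemma fbDr v lam mu : v *m lam = 0 -> v *m mu = 0 ->
  u v (lam + mu) = u v lam + u v mu.
Proof. by move=> o o'; rewrite -[lam]scale1r ub.2 // !scale1r. Qed.

Lemma fbNr v lam : v *m lam = 0 -> u v (- lam) = - u v lam.
Proof. by move=> o; rewrite -[- lam]scaleN1r fbZr // scaleN1r. Qed.

Lemma fb_suml (I : finType) (P : pred I) (c : I -> K) (v : I -> row) lam :
    (forall i, P i -> v i *m lam = 0) ->
  u (\sum_(i | P i) c i *: v i) lam = \sum_(i | P i) c i *: u (v i) lam.
Proof.
move=> o; suff [] : u (\sum_(i | P i) c i *: v i) lam
   = \sum_(i | P i) c i *: u (v i) lam /\ (\sum_(i | P i) c i *: v i) *m lam = 0.
  by [].
apply: (big_rec2 (fun a b => u b lam = a /\ b *m lam = 0)).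
  by rewrite fb0l mul0mx.
move=> i a b Pi [<- ob]; rewrite ub.1 ?o //; split=> //.
by rewrite mulmxDl ob -scalemxAl o // scaler0 addr0.
Qed.

(** Vectors without interaction: the pair may be dropped from any expansion. *)
Definition null v lam := v *m lam = 0 /\ u v lam = 0.

Lemma fb_nulll v w lam : v *m lam = 0 -> null w lam -> u (v + w) lam = u v lam.
Proof. by move=> o [o' z]; rewrite fbDl // z addr0. Qed.

Lemma fb_nullr v lam mu : v *m lam = 0 -> null v mu -> u v (lam + mu) = u v lam.
Proof. by move=> o [o' z]; rewrite fbDr // z addr0. Qed.

Lemma nullDl v w lam : null v lam -> null w lam -> null (v + w) lam.
Proof.
by move=> [o z] [o' z']; split; rewrite ?mulmxDl ?fbDl ?o ?o' ?z ?z' // addr0.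
Qed.

Lemma nullDr v lam mu : null v lam -> null v mu -> null v (lam + mu).
Proof.
by move=> [o z] [o' z']; split; rewrite ?mulmxDr ?fbDr ?o ?o' ?z ?z' // addr0.
Qed.

Lemma nullZl a v lam : null v lam -> null (a *: v) lam.
Proof. by move=> [o z]; split; rewrite -?scalemxAl ?fbZl ?o ?z // scaler0. Qed.

Lemma nullZr a v lam : null v lam -> null v (a *: lam).
Proof. by move=> [o z]; split; rewrite -?scalemxAr ?fbZr ?o ?z // scaler0. Qed.

Lemma nullNr v lam : null v lam -> null v (- lam).
Proof. by rewrite -scaleN1r; exact: nullZr. Qed.

(** When v, mu and w, lam do not interact, u (v + w) (lam - mu) is formally a
    difference of a term in v, lam and a term in w, mu, which make no sense
    separately; three such differences telescope.
    Adding to each first argument the third row, which does not interact with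
    the second argument, turns the three vectors into values of u at the same
    row v + w + z, where additivity in the second argument applies. *)
Lemma cocycle v w z lam mu nu :
    v *m lam = w *m mu -> w *m mu = z *m nu ->
    null v mu -> null v nu -> null w lam -> null w nu ->
    null z lam -> null z mu ->
  u (v + w) (lam - mu) + u (w + z) (mu - nu) = u (v + z) (lam - nu).
Proof.
move=> evw ewz vm vn wl wn zl zm.
have o (x y : row) (al be : col) : x *m al = y *m be -> null x be -> null y al ->
    (x + y) *m (al - be) = 0.
  by move=> e [h1 _] [h2 _]; rewrite mulmxDl !mulmxBr h1 h2 e subr0 sub0r subrr.
have n3 (x : row) (al be : col) : null x al -> null x be -> null x (al - be).
  by move=> *; apply: nullDr => //; apply: nullNr.
rewrite -(@fb_nulll _ z) ?(o v w) //; last exact: n3.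
rewrite -(@fb_nulll (w + z) v) ?(o w z) //; last exact: n3.
rewrite -(@fb_nulll (v + z) w) ?(o v z) ?evw //; last exact: n3.
rewrite [v + z + w]addrAC [w + z + v]addrC addrA -fbDr ?subrKA //.
- by rewrite mulmxDl o // (proj1 (n3 _ _ _ zl zm)) addr0.
- by rewrite -addrA mulmxDl o // (proj1 (n3 _ _ _ vm vn)) addr0.
Qed.
End Rules.

(** Here u vanishes at the coordinate flags and at the diagonal pairs with the
    axis 0. What is left are the values t i j x below. *)
Section Normalised.
Variables (W : lmodType K) (u : row -> col -> W) (ub : flag_bilinear u).
Hypothesis n_gt1 : (1 < n)%N.
Hypothesis u_off : forall i j, i != j -> u (er j) (fc i) = 0.
Hypothesis u_diag : forall i, u (er i + er 0) (fc i - fc 0) = 0.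

Lemma null_off i j : i != j -> null u (er i) (fc j).
Proof.
move=> ij; split; last by rewrite u_off // eq_sym.
by rewrite er_fc (negPf ij).
Qed.

Let t i j x := u (x *: er i + er j) (fc i - x *: fc j).

Lemma orth_pair i j x : i != j -> (x *: er i + er j) *m (fc i - x *: fc j) = 0.
Proof.
move=> ij; rewrite mulmxDl !mulmxBr -!scalemxAl -!scalemxAr !er_fc !eqxx.
by rewrite (negPf ij) eq_sym (negPf ij) !scaler0 subr0 sub0r subrr.
Qed.

(** In [cocycle] take the rows xy e_i, y e_j, e_k and the columns f_i, x f_j,
    xy f_k: the three differences are t i j x rescaled by y, t j k y rescaled by
    x, and t i k (xy). *)
Lemma diag_mul i j k x y : i != j -> j != k -> i != k ->
  t i k (x * y) = y *: t i j x + x *: t j k y.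
Proof.
move=> ij jk ik; rewrite /t.
have [ji kj ki] : [/\ j != i, k != j & k != i] by rewrite ![k == _]eq_sym eq_sym.
rewrite -(@cocycle _ u ub _ (y *: er j) _ _ (x *: fc j)); first 1 last.
- by rewrite -!scalemxAl -!scalemxAr !er_fc !eqxx scalerA mulrC.
- by rewrite -!scalemxAl -!scalemxAr !er_fc !eqxx scalerA mulrC.
- by apply/nullZl/nullZr/null_off.
- by apply/nullZl/nullZr/null_off.
- by apply/nullZl/null_off.
- by apply/nullZl/nullZr/null_off.
- exact/null_off.
- by apply/nullZr/null_off.
rewrite -fbZl ?orth_pair // -fbZr ?orth_pair // scalerDr scalerA [y * x]mulrC.
by rewrite scalerBr scalerA.
Qed.

(** The row (x + y) e_i + e_j + e_k is orthogonal to f_i - x f_j - y f_k. The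
    two sides expand the value of u at this pair, once along the row and once
    along the column. *)
Lemma diag_add i j k x y : i != j -> j != k -> i != k ->
  t i j (x + y) + y *: t j k 1 = t i j x + t i k y.
Proof.
move=> ij jk ik; rewrite /t !scale1r.
have [ji kj ki] : [/\ j != i, k != j & k != i] by rewrite ![k == _]eq_sym eq_sym.
have oij := orth_pair _ ij; have oik := orth_pair _ ik.
have ojk : (er j + er k) *m (fc j - fc k) = 0.
  by have := orth_pair 1 jk; rewrite !scale1r.
have nb (a b c : 'I_n.+1) z : a != b -> a != c -> null u (er a) (fc b - z *: fc c).
  by move=> ab ac; apply: nullDr => //; [exact: null_off|apply/nullNr/nullZr/null_off].
have e1 : u ((x + y) *: er i + er j + er k) (fc i - (x + y) *: fc j) =
          u ((x + y) *: er i + er j) (fc i - (x + y) *: fc j).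
  by rewrite fb_nulll //; apply: nb.
have [ojk' zjk] : null u (er i) (fc j - fc k).
  by have := nb i j k 1 ij ik; rewrite scale1r.
have e2 : u ((x + y) *: er i + er j + er k) (fc j - fc k) =
          u (er j + er k) (fc j - fc k).
  by rewrite -addrA addrC fb_nulll //; apply: nullZl.
have e3 : u (x *: er i + er j) (fc i - x *: fc j - y *: fc k) =
          u (x *: er i + er j) (fc i - x *: fc j).
  apply: fb_nullr => //; apply/nullNr/nullZr => //.
  by apply: nullDl => //; [apply: nullZl => //|]; apply: null_off.
have e4 : u (y *: er i + er k) (fc i - x *: fc j - y *: fc k) =
          u (y *: er i + er k) (fc i - y *: fc k).
  rewrite addrAC; apply: fb_nullr => //; apply/nullNr/nullZr => //.
  by apply: nullDl => //; [apply: nullZl => //|]; apply: null_off.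
have ov : ((x + y) *: er i + er j + er k) *m (fc j - fc k) = 0.
  by rewrite -addrA mulmxDl ojk -scalemxAl ojk' scaler0 addr0.
rewrite -e1 -e2 -e3 -e4 -fbZr // -fbDr //; first last.
- by rewrite -scalemxAr ov scaler0.
- by rewrite mulmxDl orth_pair // (proj1 (nb _ _ _ _ ki kj)) addr0.
rewrite -fbDl //; first last.
- rewrite addrAC mulmxBr oik -scalemxAr mulmxDl -scalemxAl !er_fc.
  by rewrite (negPf ij) (negPf kj) !scaler0 addr0 scaler0 subr0.
- rewrite mulmxBr oij -scalemxAr mulmxDl -scalemxAl !er_fc.
  by rewrite (negPf ik) (negPf jk) !scaler0 addr0 scaler0 subr0.
by congr u; apply/matrixP=> a b; rewrite !mxE; ring.
Qed.

Lemma exists_third (i j : 'I_n.+1) : exists k, (k != i) && (k != j).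
Proof.
have /card_gt0P[k] : (0 < #|~: [set i; j]|)%N.
  rewrite cardsCs finset.setCK card_ord subn_gt0 cards2.
  by case: (i != j); rewrite // ltnW.
by rewrite !inE negb_or => H; exists k.
Qed.

Let diag_normal i : i != 0 -> t i 0 1 = 0.
Proof. by rewrite /t !scale1r. Qed.

Let diag_opp i j : i != j -> t i j 1 = - t j i 1.
Proof.
move=> ij; rewrite /t !scale1r addrC -opprB fbNr //.
by rewrite eq_sym in ij; have := orth_pair 1 ij; rewrite !scale1r.
Qed.

Let diag1 i j : i != j -> t i j 1 = 0.
Proof.
have [->|i0] := eqVneq i 0; last have [->|j0] := eqVneq j 0 => ij.
- by move=> ij; rewrite diag_opp // diag_normal ?oppr0 // eq_sym.
- exact: diag_normal.
have := @diag_mul i 0 j 1 1; rewrite mulr1 => -> //; last by rewrite eq_sym.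
by rewrite !scale1r [t 0 j 1]diag_opp 1?eq_sym // !diag_normal // subr0.
Qed.

Let diag_left i j k x : i != j -> i != k -> t i k x = t i j x.
Proof.
have [->//|jk ij ik] := eqVneq j k.
rewrite -[x in LHS]mulr1 (diag_mul _ _ ij) // diag1 //.
by rewrite scaler0 addr0 scale1r.
Qed.

Let diag_right i j k x : i != k -> j != k -> t i k x = t j k x.
Proof.
have [->//|ij ik jk] := eqVneq i j.
rewrite -[x in LHS]mul1r (diag_mul _ _ ij) // diag1 //.
by rewrite scaler0 add0r scale1r.
Qed.

(* Two pairs of axes are joined by changing one axis at a time; the third axis k
   is needed to avoid the degenerate pair when i' = j. *)
Let diag_indep i j i' j' x : i != j -> i' != j' -> t i j x = t i' j' x.
Proof.
move=> ij ij'; have [ji|ij2] := eqVneq i' j; last first.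
  by rewrite (@diag_right i i') // (@diag_left i' j').
have [k /andP[ki kj]] := exists_third i j.
rewrite (@diag_left i k) // 1?eq_sym // (@diag_right i i') ?ji 1?eq_sym //.
by rewrite -ji (@diag_left i' j') // ji eq_sym.
Qed.

(** The sign makes this the derivation d itself when u v lam = v *m d(lam). *)
Definition diag_der x := - u (x *: er ord_max + er 0) (fc ord_max - x *: fc 0).

Let max_neq0 : ord_max != 0 :> 'I_n.+1.
Proof. by rewrite -val_eqE /= -lt0n ltnW. Qed.

Let diagE i j x : i != j -> t i j x = - diag_der x.
Proof. by move=> ij; rewrite /diag_der opprK; exact: diag_indep. Qed.

Lemma diag_derD x y : diag_der (x + y) = diag_der x + diag_der y.
Proof.
have [k /andP[ki kj]] := exists_third ord_max 0.
rewrite eq_sym in ki; rewrite eq_sym in kj.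
have := diag_add x y max_neq0 kj ki; rewrite diag1 // scaler0 addr0.
by rewrite !diagE // -opprD => /oppr_inj.
Qed.

Lemma diag_derM x y : diag_der (x * y) = y *: diag_der x + x *: diag_der y.
Proof.
have [k /andP[ki kj]] := exists_third ord_max 0.
rewrite eq_sym in ki; rewrite eq_sym in kj.
have := diag_mul x y max_neq0 kj ki.
by rewrite !diagE // !scalerN -opprD => /oppr_inj.
Qed.

(** If lam_i <> 0, the kernel of lam is spanned by the rows
    e_j - (lam_j / lam_i) e_i with j <> i, and on such a row u only sees the
    entries i and j of lam, where it is given by t i j. *)
Lemma normalisedE v lam : v *m lam = 0 ->
  u v lam = \sum_i v 0 i *: diag_der (lam i 0).
Proof.
move=> vl; have [->|/cV0Pn[i li0]] := eqVneq lam 0.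
  have d0 : diag_der 0 = 0.
    by have := diag_derD 0 0; rewrite addr0 -[LHS]addr0 => /addrI.
  by rewrite fb0r // big1 // => i _; rewrite mxE d0 scaler0.
set a := lam i 0 in li0.
have vi : v 0 i = - \sum_(j | j != i) v 0 j * (lam j 0 / a).
  have /rowP/(_ 0) := vl; rewrite !mxE (bigD1 i) //= => /eqP.
  rewrite addr_eq0 => /eqP vi; rewrite -[LHS](mulfK li0) vi mulNr; congr (- _).
  by rewrite mulr_suml; apply: eq_bigr => j _; rewrite mulrA.
have vE : v = \sum_(j | j != i) v 0 j *: (- (lam j 0 / a) *: er i + er j).
  apply/rowP=> k; rewrite summxE; have [->|ki] := eqVneq k i.
    rewrite vi -sumrN; apply: eq_bigr => j ji; rewrite !mxE !eqxx.
    by rewrite (eq_sym i j) (negPf ji) /=; ring.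
  rewrite (bigD1 k) //= big1 => [|j /andP[ji jk]]; rewrite !mxE !eqxx (negPf ki).
    by rewrite /=; ring.
  by rewrite (eq_sym k j) (negPf jk) /=; ring.
have lE : lam = \sum_j lam j 0 *: fc j.
  apply/colP=> k; rewrite summxE (bigD1 k) //= big1 => [|j jk]; rewrite !mxE !eqxx.
    by rewrite mulr1 addr0.
  by rewrite eq_sym (negPf jk) mulr0.
have uj j : j != i -> let w := - (lam j 0 / a) *: er i + er j in
    w *m lam = 0 /\ u w lam = a *: diag_der (lam j 0 / a).
  move=> ji w; have ij : i != j by rewrite eq_sym.
  have wl : w *m (a *: (fc i - - (lam j 0 / a) *: fc j)) = 0.
    by rewrite -scalemxAr orth_pair // scaler0.
  have lw : lam = a *: (fc i - - (lam j 0 / a) *: fc j)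
                  + \sum_(k | (k != i) && (k != j)) lam k 0 *: fc k.
    rewrite [LHS]lE (bigD1 i) //= (bigD1 j) //= addrA; congr (_ + _).
    by rewrite scaleNr opprK scalerDr scalerA mulrC divfK.
  have wn : null u w (\sum_(k | (k != i) && (k != j)) lam k 0 *: fc k).
    apply: (big_ind (null u w)); first by split; rewrite ?mulmx0 ?fb0r.
      exact: nullDr.
    move=> k /andP[ki kj]; apply: nullZr => //.
    by apply: nullDl => //; [apply: nullZl => //|]; apply: null_off; rewrite eq_sym.
  split; first by rewrite lw mulmxDr wl wn.1 addr0.
  rewrite {1}lw fb_nullr // fbZr ?orth_pair // -[u _ _]/(t i j _) diagE //.
  congr (_ *: _); apply/esym/eqP; rewrite -subr_eq0 opprK -diag_derD addrN.
  by apply/eqP; have := diag_derD 0 0; rewrite addr0 -[LHS]addr0 => /addrI.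
rewrite [in LHS]vE fb_suml //; last by move=> j ji; case: (uj j ji).
rewrite [RHS](bigD1 i) //= vi scaleNr scaler_suml -sumrN -big_split /=.
apply: eq_bigr => j ji; have [_ ->] := uj j ji.
have -> : diag_der (lam j 0) =
    a *: diag_der (lam j 0 / a) + (lam j 0 / a) *: diag_der a.
  by rewrite -diag_derM divfK.
by rewrite scalerDr !scalerA addrC addrK.
Qed.

End Normalised.
End FlagBilinear.

(** * Splitting off a linear map on matrices *)

Section Frame.
Variables (n : nat) (K : fieldType).
Local Notation row := 'rV[K]_n.+1.
Local Notation col := 'cV[K]_n.+1.
Local Notation er := (@er n K).
Local Notation fc := (@fc n K).

(** Vector above the matrix unit E_ij if i <> j, and above E_ii - E_00 if i = j.
    For i = j = 0 the arguments are not all orthogonal, but the first term is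
    taken at the zero column and the other two cancel. *)
Definition frame (W : lmodType K) (u : row -> col -> W) (i j : 'I_n.+1) : W :=
  if i == j then u (er i + er 0) (fc i - fc 0) - u (er 0) (fc i) + u (er i) (fc 0)
  else u (er j) (fc i).

Definition frame_map (W : lmodType K) (u : row -> col -> W) (a : 'M[K]_n.+1) : W :=
  \sum_i \sum_j a i j *: frame u i j.

Definition defect (W : lmodType K) (u : row -> col -> W) v lam : W :=
  u v lam - frame_map u (lam *m v).

(** The derivation K -> W that measures how far u is from being induced by a
    linear map on matrices. *)
Definition frame_der (W : lmodType K) (u : row -> col -> W) : K -> W :=
  diag_der (defect u).

Lemma diag_orth i : i != 0 ->
  [/\ (er i + er 0) *m (fc i - fc 0) = 0, er 0 *m fc i = 0 & er i *m fc 0 = 0].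
Proof.
move=> i0; split; last by rewrite er_fc (negPf i0).
  by have := @orth_pair n K _ _ 1 i0; rewrite !scale1r.
by rewrite er_fc eq_sym (negPf i0).
Qed.

Lemma off_orth i j : i != j -> er j *m fc i = 0.
Proof. by move=> ij; rewrite er_fc eq_sym (negPf ij). Qed.

Lemma ord_max_neq0 : (1 < n)%N -> ord_max != 0 :> 'I_n.+1.
Proof. by move=> n_gt1; rewrite -val_eqE /= -lt0n ltnW. Qed.

Section Linear.
Variables (W : lmodType K) (u : row -> col -> W).

Lemma frame_map_linear a x y :
  frame_map u (a *: x + y) = a *: frame_map u x + frame_map u y.
Proof.
rewrite /frame_map scaler_sumr -big_split /=; apply: eq_bigr => i _.
rewrite scaler_sumr -big_split /=; apply: eq_bigr => j _.
by rewrite !mxE scalerDl scalerA.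
Qed.

Lemma frame_mapD x y : frame_map u (x + y) = frame_map u x + frame_map u y.
Proof. by rewrite -[x]scale1r frame_map_linear !scale1r. Qed.

Lemma frame_mapB x y : frame_map u (x - y) = frame_map u x - frame_map u y.
Proof. by rewrite addrC -[- y]scaleN1r frame_map_linear scaleN1r addrC. Qed.

Lemma frame_map0 : frame_map u 0 = 0.
Proof. by rewrite -[0 in LHS](subrr 0) frame_mapB subrr. Qed.

Lemma frame_map_delta i j : frame_map u (delta_mx i j) = frame u i j.
Proof.
rewrite /frame_map (bigD1 i) //= (bigD1 j) //= !big1 => [|k /negPf ki|k /negPf kj].
- by rewrite mxE !eqxx scale1r !addr0.
- by rewrite big1 // => l _; rewrite mxE ki scale0r.
- by rewrite mxE kj andbF scale0r.
Qed.
End Linear.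

Section FlagBilinearFrame.
Variables (W : lmodType K) (u : row -> col -> W) (ub : flag_bilinear u).

Lemma defect_bilinear : flag_bilinear (defect u).
Proof.
split=> [lam a v w ov ow|v a lam mu ol om]; rewrite /defect.
  rewrite ub.1 // mulmxDr -scalemxAr frame_map_linear scalerBr opprD.
  by rewrite addrACA.
rewrite ub.2 // mulmxDl -scalemxAl frame_map_linear scalerBr opprD.
by rewrite addrACA.
Qed.

Lemma fc_er i j : fc i *m er j = delta_mx i j.
Proof. by rewrite mul_delta_mx. Qed.

Lemma frame00 : frame u 0 0 = 0.
Proof. by rewrite /frame eqxx subrr fb0r // sub0r addNr. Qed.

Lemma defect_off i j : i != j -> defect u (er j) (fc i) = 0.
Proof.
by move=> ij; rewrite /defect fc_er frame_map_delta /frame (negPf ij) subrr.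
Qed.

Lemma defect_diag i : defect u (er i + er 0) (fc i - fc 0) = 0.
Proof.
rewrite /defect; have [->|i0] := eqVneq i 0.
  by rewrite subrr fb0r // mul0mx frame_map0 subrr.
rewrite mulmxDr !mulmxBl !fc_er frame_mapD !frame_mapB !frame_map_delta frame00.
rewrite /frame eqxx (negPf i0) eq_sym (negPf i0) subr0.
by rewrite addrK subrK subrr.
Qed.

Variable n_gt1 : (1 < n)%N.

Lemma flag_bilinearE v lam : v *m lam = 0 ->
  u v lam = frame_map u (lam *m v) + \sum_i v 0 i *: frame_der u (lam i 0).
Proof.
move=> vl; rewrite -(normalisedE defect_bilinear n_gt1 defect_off defect_diag vl).
by rewrite /defect addrC subrK.
Qed.

Lemma frame_derD x y : frame_der u (x + y) = frame_der u x + frame_der u y.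
Proof. exact: (diag_derD defect_bilinear n_gt1 defect_off defect_diag). Qed.

Lemma frame_derM x y :
  frame_der u (x * y) = y *: frame_der u x + x *: frame_der u y.
Proof. exact: (diag_derM defect_bilinear n_gt1 defect_off defect_diag). Qed.

(** Although [frame_map u] is built from values of u, it lands in the span of the
    values at orthogonal pairs only. *)
Lemma frame_map_closed (N : set W) a : lin_closed N ->
  (forall v lam, v *m lam = 0 -> N (u v lam)) -> N (frame_map u a).
Proof.
move=> cN Nu; do 2!apply: lin_closed_sum => // ?; apply: lin_closedZ => //.
set i := (X in frame _ X _); set j := (X in frame _ _ X).
have [ij|ij] := eqVneq i j; last first.
  by rewrite /frame (negPf ij); apply: Nu; exact: off_orth.
rewrite -ij; have [->|i0] := eqVneq i 0; first by rewrite frame00; exact: cN.1.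
have [o1 o2 o3] := diag_orth i0; rewrite /frame eqxx.
apply: lin_closedD => //; first apply: lin_closedB => //; exact: Nu.
Qed.

Lemma frame_der_closed (N : set W) x : lin_closed N ->
  (forall v lam, v *m lam = 0 -> N (u v lam)) -> N (frame_der u x).
Proof.
move=> cN Nu; rewrite /frame_der /diag_der -scaleN1r; apply: lin_closedZ => //.
apply: lin_closedB => //; last exact: frame_map_closed.
by apply/Nu/orth_pair; exact: (ord_max_neq0 n_gt1).
Qed.

End FlagBilinearFrame.

(** Naturality: a linear map carrying u to u' at orthogonal pairs carries the
    data extracted from u to those extracted from u'. *)
Section Image.
Variables (W W' : lmodType K) (F : {linear W -> W'}).
Variables (u : row -> col -> W) (u' : row -> col -> W').
Hypotheses (ub : flag_bilinear u) (ub' : flag_bilinear u').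
Hypothesis Fu : forall v lam, v *m lam = 0 -> F (u v lam) = u' v lam.

Lemma frame_map_image a : F (frame_map u a) = frame_map u' a.
Proof.
rewrite /frame_map linear_sum; apply: eq_bigr => i _.
rewrite linear_sum; apply: eq_bigr => j _; rewrite linearZ; congr (_ *: _).
have [<-|ij] := eqVneq i j; last first.
  by rewrite /frame (negPf ij) Fu //; exact: off_orth.
have [->|i0] := eqVneq i 0; first by rewrite !frame00 // linear0.
by have [o1 o2 o3] := diag_orth i0; rewrite /frame eqxx linearD linearB !Fu.
Qed.

Lemma frame_der_image x : (1 < n)%N -> F (frame_der u x) = frame_der u' x.
Proof.
move=> n_gt1; rewrite /frame_der /diag_der /defect linearN linearB frame_map_image.
by rewrite Fu //; apply: orth_pair; exact: (ord_max_neq0 n_gt1).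
Qed.

End Image.

Definition pure_form v lam : adjoint n K := pure lam v.

Lemma pure_bilinear : flag_bilinear pure_form.
Proof.
split=> [lam a v w ov ow|v a lam mu ol om]; apply: val_inj; rewrite /= /pure_form.
  by rewrite !pureE ?mulmxDl -?scalemxAl ?ov ?ow ?scaler0 ?addr0 // mulmxDr scalemxAr.
by rewrite !pureE ?mulmxDr -?scalemxAr ?ol ?om ?scaler0 ?addr0 // mulmxDl scalemxAl.
Qed.

Lemma frame_pure (a : adjoint n K) : frame_map pure_form a = a.
Proof.
apply: val_inj; rewrite /= /frame_map.
have -> : val (\sum_i \sum_j (a : 'M_n.+1) i j *: frame pure_form i j) =
   \sum_i \sum_j (a : 'M_n.+1) i j *: val (frame pure_form i j).
  by rewrite linear_sum; apply: eq_bigr => i _; rewrite linear_sum.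
have fE i j : val (frame pure_form i j) = delta_mx i j - (i == j)%:R *: delta_mx 0 0.
  have [<-|ij] := eqVneq i j; last first.
    by rewrite /frame (negPf ij) scale0r subr0 /= pureE ?fc_er //; exact: off_orth.
  rewrite scale1r; have [->|i0] := eqVneq i 0.
    by rewrite frame00 ?subrr //; exact: pure_bilinear.
  have [o1 o2 o3] := diag_orth i0; rewrite /frame eqxx linearD linearB /= !pureE //.
  by rewrite mulmxDr !mulmxBl !fc_er; apply/matrixP=> p q; rewrite !mxE; ring.
under eq_bigr do under eq_bigr do rewrite fE scalerBr.
under eq_bigr do rewrite big_split /=.
rewrite big_split /= -matrix_sum_delta.
rewrite [X in _ + X](_ : _ = 0) ?addr0 //.
have /eqP tr0 : \tr (a : 'M_n.+1) == 0 by exact: (valP a).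
transitivity (- (\tr (a : 'M_n.+1) *: delta_mx 0 0 : 'M[K]_n.+1)); last first.
  by rewrite tr0 scale0r oppr0.
rewrite /mxtrace scaler_suml -sumrN; apply: eq_bigr => i _.
rewrite (bigD1 i) //= big1 ?addr0 ?eqxx ?scale1r // => j ji.
by rewrite eq_sym (negPf ji) scale0r scaler0 oppr0.
Qed.

(** The first coordinate of the explicit model, one derivation at a time. It is
    linear in lam at orthogonal pairs because d(a lam) = a d(lam) + d(a) lam. *)
Definition der_form (d : K -> K) (v : row) (lam : col) : K^o := (v *m map_mx d lam) 0 0.

Section DerForm.
Variables (d : K -> K) (dd : is_derivation d).

Lemma der0 : d 0 = 0.
Proof. by have := dd.1 0 0; rewrite addr0 -[LHS]addr0 => /addrI. Qed.

Lemma der1 : d 1 = 0.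
Proof. by have := dd.2 1 1; rewrite !mulr1 mul1r -[LHS]addr0 => /addrI. Qed.

Lemma derN x : d (- x) = - d x.
Proof. by apply/eqP; rewrite -addr_eq0 -dd.1 addNr der0. Qed.

Lemma map_mxD_der p q (A B : 'M[K]_(p, q)) :
  map_mx d (A + B) = map_mx d A + map_mx d B.
Proof. by apply/matrixP=> i j; rewrite !mxE dd.1. Qed.

Lemma der_sum (I : finType) (F : I -> K) : d (\sum_i F i) = \sum_i d (F i).
Proof. by apply: (big_morph d dd.1 der0). Qed.

Lemma map_mxM_der p q r (A : 'M[K]_(p, q)) (B : 'M[K]_(q, r)) :
  map_mx d (A *m B) = map_mx d A *m B + A *m map_mx d B.
Proof.
apply/matrixP=> i j; rewrite !mxE der_sum -big_split /=; apply: eq_bigr => k _.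
by rewrite !mxE dd.2.
Qed.

Lemma der_form_bilinear : flag_bilinear (der_form d).
Proof.
split=> [lam a v w _ _|v a lam mu ol _]; rewrite /der_form.
  by rewrite mulmxDl -scalemxAl !mxE.
have -> : map_mx d (a *: lam + mu) = a *: map_mx d lam + d a *: lam + map_mx d mu.
  by apply/matrixP=> i j; rewrite !mxE dd.1 dd.2; ring.
by rewrite !mulmxDr -!scalemxAr ol scaler0 addr0 !mxE.
Qed.

(** Derivations vanish on 0, 1 and -1, the entries of all columns of the
    frame. *)
Lemma frame_der_form a : frame_map (der_form d) a = 0.
Proof.
rewrite /frame_map big1 // => i _; rewrite big1 // => j _.
have z v k : der_form d v (fc k) = 0.
  rewrite /der_form (_ : map_mx d _ = 0) ?mulmx0 ?mxE //.
  by apply/matrixP=> p q; rewrite !mxE; case: (_ && _); rewrite ?der0 ?der1.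
have z' v k l : der_form d v (fc k - fc l) = 0.
  rewrite /der_form map_mxD_der mulmxDr mxE -/(der_form _ _ _) z.
  rewrite (_ : map_mx d _ = - map_mx d (fc l)).
    by rewrite mulmxN mxE -/(der_form _ _ _) z oppr0 addr0.
  by apply/matrixP=> p q; rewrite !mxE derN.
by rewrite /frame z' !z; case: ifP; rewrite ?subrr ?addr0 scaler0.
Qed.

Lemma frame_der_der_form x : (1 < n)%N -> frame_der (der_form d) x = d x.
Proof.
move=> n_gt1; rewrite /frame_der /diag_der /defect frame_der_form subr0 /der_form.
have -> : map_mx d (fc ord_max - x *: fc 0) = - d x *: fc 0.
  apply/matrixP=> i j; rewrite !mxE dd.1 derN dd.2.
  have -> (b : bool) : d b%:R = 0 by case: b; rewrite ?der0 ?der1.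
  have -> (b : bool) : d b%:R = 0 by case: b; rewrite ?der0 ?der1.
  by rewrite mulr0 addr0 add0r mulNr.
rewrite -scalemxAr mulmxDl -scalemxAl !er_fc (negPf (ord_max_neq0 n_gt1)).
rewrite scaler0 add0r !mxE.
by rewrite mulr1 opprK.
Qed.

End DerForm.

Lemma frame_der_pure x : (1 < n)%N -> frame_der pure_form x = 0.
Proof.
move=> n_gt1; rewrite /frame_der /diag_der /defect -pureE ?frame_pure ?subrr ?oppr0 //.
by apply: orth_pair; exact: (ord_max_neq0 n_gt1).
Qed.

End Frame.

(** * Sums with finite support and derivation bases *)

Section FiniteSupport.
Variables (K : fieldType) (I : choiceType) (D : set I).

Definition fin_supp (c : I -> K) : Prop := finite_set (D `&` [set i | c i != 0]).

Lemma fin_suppD a c c' :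
  fin_supp c -> fin_supp c' -> fin_supp (fun i => a * c i + c' i).
Proof.
move=> fc fc'; have fU :
    finite_set ((D `&` [set i | c i != 0]) `|` (D `&` [set i | c' i != 0])).
  by rewrite finite_setU.
apply: sub_finite_set fU => i [Di /= nz]; have [c0|c0] := eqVneq (c i) 0; last by left.
by right; split=> //=; move: nz; rewrite c0 mulr0 add0r.
Qed.

Lemma fin_supp_seq c : fin_supp c ->
  exists r : seq I,
    [/\ uniq r, [set` r] `<=` D & forall i, D i -> i \notin r -> c i = 0].
Proof.
move=> /finite_seqP[r rE]; exists (undup r); split=> [||i Di].
- exact: undup_uniq.
- move=> i /=; rewrite mem_undup => ri.
  by have [] : (D `&` [set i | c i != 0]) i by rewrite rE.
- rewrite mem_undup => /negP ri; apply: contra_notP ri => /eqP nz.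
  by rewrite -[is_true _]/([set` r] i) -rE.
Qed.

Variable V : lmodType K.

Lemma fsum_linear a c c' (x : I -> V) : fin_supp c -> fin_supp c' ->
  \sum_(i \in D) (a * c i + c' i) *: x i =
  a *: (\sum_(i \in D) c i *: x i) + \sum_(i \in D) c' i *: x i.
Proof.
move=> fc fc'; have [r [ur rD r0]] := fin_supp_seq fc.
have [r' [ur' rD' r0']] := fin_supp_seq fc'.
pose s := undup (r ++ r').
have us : uniq s by exact: undup_uniq.
have sD : [set` s] `<=` D.
  by move=> i /=; rewrite mem_undup mem_cat => /orP[/rD|/rD'].
have s0 i : D i -> i \notin s -> c i = 0 /\ c' i = 0.
  by move=> Di; rewrite mem_undup mem_cat negb_or => /andP[/(r0 i Di) + /(r0' i Di)].
rewrite !(fsbigE s) //; first last.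
- by move=> i Di /(s0 i Di)[-> ->]; rewrite mulr0 addr0 scale0r.
- by move=> i Di /(s0 i Di)[-> _]; rewrite scale0r.
- by move=> i Di /(s0 i Di)[_ ->]; rewrite scale0r.
rewrite scaler_sumr -big_split; apply: eq_bigr => i _.
by rewrite scalerDl scalerA.
Qed.

Lemma fsum_additive (V' : lmodType K) (G : {linear V -> V'}) c x : fin_supp c ->
  G (\sum_(i \in D) c i *: x i) = \sum_(i \in D) c i *: G (x i).
Proof.
move=> fc; have [r [ur rD r0]] := fin_supp_seq fc.
rewrite !(fsbigE r) //; try by move=> i Di /(r0 i Di) ->; rewrite scale0r.
by rewrite linear_sum; apply: eq_bigr => i _; rewrite linearZ.
Qed.

Lemma fin_supp_delta j : fin_supp (fun i => (j == i)%:R).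
Proof.
apply: (@sub_finite_set _ _ [set j]); last exact: finite_set1.
by move=> i [_] /=; have [->//|_] := eqVneq j i; rewrite eqxx.
Qed.

Lemma fsum_delta (x : I -> V) j : D j -> \sum_(i \in D) (j == i)%:R *: x i = x j.
Proof.
move=> Dj; rewrite (fsbigE [:: j]) //.
- by rewrite big_cons big_nil mem_set //= eqxx scale1r addr0.
- by move=> i /=; rewrite inE => /eqP ->.
- by move=> i _; rewrite inE => /negPf ij; rewrite eq_sym ij scale0r.
Qed.
End FiniteSupport.

Section DerivationBasis.
Variables (K : fieldType) (Omega : set K) (OmegaP : is_derivation_basis Omega).

Lemma der_atP w : is_derivation (der_at Omega w) /\
  forall w', Omega w' -> der_at Omega w w' = (w' == w)%:R.
Proof.
apply: (@xgetPex _ (fun=> 0) [set d | is_derivation d /\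
                          forall w', Omega w' -> d w' = (w' == w)%:R]).
by have [d [dP _]] := OmegaP.2 (fun w' => (w' == w)%:R); exists d.
Qed.

Lemma der_eq0 d : is_derivation d -> (forall w, Omega w -> d w = 0) -> d = fun=> 0.
Proof.
move=> dd d0; have [e [_ e_uniq]] := OmegaP.2 (fun=> 0).
rewrite -(e_uniq d) //; apply: e_uniq; split=> //.
by split=> x y; rewrite ?mul0r ?mulr0 addr0.
Qed.

Definition der_eval (x : K) (m : DerO Omega) : K^o := der_val m x.

Lemma der_eval_linear x : linear (der_eval x).
Proof. by []. Qed.
HB.instance Definition _ x :=
  GRing.isLinear.Build K (DerO Omega) K^o *:%R (der_eval x) (der_eval_linear x).

Lemma derO_ind (N : set (DerO Omega)) : lin_closed N ->
  (forall w, Omega w -> N (derO_elt Omega w)) -> forall m, N m.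
Proof.
move=> cN Nw m; have /asboolP[k [c [y [Sy mE]]]] := der_valP m.
have -> : m = \sum_(i < k) c i *:
    derO_elt Omega (xget 0 [set w | Omega w /\ der_at Omega w = y i]).
  apply: val_inj; rewrite [LHS]mE linear_sum; apply: eq_bigr => i _.
  have [w Ow wy] := Sy i.
  case: xgetP => [w' _ [Ow' <-]|/(_ w) []//].
  by rewrite -[RHS]/(_ *: der_val _) derO_eltE.
apply: lin_closed_sum => // i; apply: lin_closedZ => //; apply: Nw.
have [w Ow wy] := Sy i.
by case: xgetP => [w' _ []//|/(_ w) []//].
Qed.

End DerivationBasis.

Section Adjoint.
Variables (n : nat) (K : fieldType).

Lemma adj_val_linear : linear (@adj_val n K).
Proof. by move=> c a b; exact: (linearP (val : adjoint n K -> 'M_n.+1)). Qed.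

Lemma adj_val0 : adj_val (0 : adjoint n K) = 0.
Proof. exact: (linear0 (val : adjoint n K -> 'M_n.+1)). Qed.

Lemma adj_act_linear (g : SL n K) : linear (fun a : adjoint n K => adj_act a g).
Proof.
move=> c a b; apply: val_inj; rewrite [RHS]adj_val_linear.
rewrite -[LHS]/(invmx g *m adj_val (c *: a + b) *m g) adj_val_linear.
by rewrite mulmxDr mulmxDl -scalemxAr -scalemxAl.
Qed.
End Adjoint.

(** * The module spanned by the values of a map bilinear on orthogonal pairs *)

(** The maps phi and ell w play the roles of the projection onto the traceless
    matrices and of the coordinate along der_at Omega w. *)
Section Model.
Variables (n : nat) (K : fieldType) (n_gt1 : (1 < n)%N).
Variables (Omega : set K) (OmegaP : is_derivation_basis Omega).
Variables (W : lmodType K) (u : 'rV[K]_n.+1 -> 'cV[K]_n.+1 -> W).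
Variables (ub : flag_bilinear u).
Hypothesis u_span : forall N : set W, lin_closed N ->
  (forall v lam, v *m lam = 0 -> N (u v lam)) -> forall w, N w.
Variables (phi : {linear W -> adjoint n K}) (ell : K -> {linear W -> K^o}).
Hypothesis phiE : forall v lam, v *m lam = 0 -> phi (u v lam) = pure lam v.
Hypothesis ellE : forall w v lam, v *m lam = 0 ->
  ell w (u v lam) = der_form (der_at Omega w) v lam.

Lemma phi_frame (a : adjoint n K) : phi (frame_map u a) = a.
Proof.
by rewrite (@frame_map_image _ _ _ _ phi _ _ ub (@pure_bilinear n K)) // frame_pure.
Qed.

Lemma phi_frame_der x : phi (frame_der u x) = 0.
Proof.
by rewrite (@frame_der_image _ _ _ _ phi _ _ ub (@pure_bilinear n K)) // frame_der_pure.
Qed.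

Lemma ell_frame w a : ell w (frame_map u a) = 0.
Proof.
have [dw _] := der_atP OmegaP w.
rewrite (@frame_map_image _ _ _ _ (ell w) _ _ ub (@der_form_bilinear n K _ dw)).
  exact: frame_der_form.
by move=> *; exact: ellE.
Qed.

Lemma ell_frame_der w x : ell w (frame_der u x) = der_at Omega w x.
Proof.
have [dw _] := der_atP OmegaP w.
rewrite (@frame_der_image _ _ _ _ (ell w) _ _ ub (@der_form_bilinear n K _ dw)) //.
  exact: frame_der_der_form.
by move=> *; exact: ellE.
Qed.

(** A linear form that kills the vectors frame_der u w, w in Omega, composes with
    frame_der u to a derivation vanishing on Omega, hence to 0 by uniqueness in
    the definition of a derivation basis; and linear forms separate vectors from
    subspaces. *)
Lemma frame_der_span x : lin_span (frame_der u @` Omega) (frame_der u x).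
Proof.
apply: contrapT => /separating_functional[l [l0 lx]].
have ld : is_derivation (l \o frame_der u).
  split=> y z /=; first by rewrite frame_derD // linearD.
  by rewrite frame_derM // linearD !linearZ; congr (_ + _); exact: mulrC.
have := der_eq0 OmegaP ld (fun w Ow => l0 _ (ex_intro2 _ _ w Ow erefl)).
by move=> /(congr1 (fun f => f x)) /=; rewrite lx => /eqP; rewrite oner_eq0.
Qed.

Lemma model_decomp w : lin_span (frame_der u @` Omega) (w - frame_map u (phi w)).
Proof.
have cS := lin_span_closed (frame_der u @` Omega).
apply: (u_span (N := [set w |
  lin_span (frame_der u @` Omega) (w - frame_map u (phi w))])).
  split=> [|a x y Nx Ny] /=; first by rewrite linear0 frame_map0 subr0; exact: cS.1.
  have := cS.2 a _ _ Nx Ny; rewrite linearP frame_map_linear.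
  by rewrite scalerBr opprD addrACA.
move=> v lam vl /=; rewrite phiE // pureE // (flag_bilinearE ub) // addrC addKr.
by apply: lin_closed_sum => // i; apply: lin_closedZ => //; exact: frame_der_span.
Qed.

(** The forms ell w are dual to the spanning vectors frame_der u w and kill
    frame_map u, so only the indices w of a finite expansion survive. In
    particular each x in K has der_at Omega w x = 0 for almost all w. *)
Lemma ell_fin_supp x : fin_supp Omega (fun w => ell w x).
Proof.
rewrite -[x](subrK (frame_map u (phi x))).
have -> : (fun w => ell w (x - frame_map u (phi x) + frame_map u (phi x))) =
          (fun w => ell w (x - frame_map u (phi x))).
  by apply/funext=> w; rewrite linearD ell_frame addr0.
apply: (@lin_span_min _ _ _ [set y | fin_supp Omega (fun w => ell w y)]
  _ _ _ (model_decomp x)).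
  split=> [|a y z fy fz] /=.
    by apply: (@sub_finite_set _ _ set0) => // w [_] /=; rewrite linear0 eqxx.
  under [X in fin_supp _ X]eq_fun do rewrite linearP.
  exact: fin_suppD.
move=> _ [w0 Ow0 <-] /=; apply: sub_finite_set (@fin_supp_delta K K Omega w0).
by move=> w [Ow] /=; rewrite ell_frame_der (der_atP OmegaP w).2.
Qed.

Definition model_map (x : W) : MA n Omega :=
  (\sum_(w \in Omega) (ell w x : K) *: derO_elt Omega w, phi x).

Lemma model_map_linear : linear model_map.
Proof.
move=> a x y; apply/pair_equal_spec; split => /=; last by rewrite linearP.
rewrite -fsum_linear //; try exact: ell_fin_supp.
by apply: eq_fsbigr => w _; rewrite linearP.
Qed.

Lemma model_map_u v lam : v *m lam = 0 -> model_map (u v lam) = MA_vec Omega v lam.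
Proof.
move=> vl; congr pair; last exact: phiE.
by apply: eq_fsbigr => w _; rewrite ellE.
Qed.

Lemma ker_phi_expansion x : phi x = 0 ->
  x = \sum_(w \in Omega) (ell w x : K) *: frame_der u w.
Proof.
move=> x0; have := model_decomp x; rewrite x0 frame_map0 subr0.
apply: (@lin_span_min _ _ _
  [set y | y = \sum_(w \in Omega) (ell w y : K) *: frame_der u w]).
  split=> [|a y z /= yE zE].
    by rewrite /= fsbig1 // => w _; rewrite linear0 scale0r.
  rewrite {1}yE {1}zE -fsum_linear //; try exact: ell_fin_supp.
  by apply: eq_fsbigr => w _; rewrite linearP.
move=> _ [w0 Ow0 <-] /=; rewrite -[LHS](fsum_delta (frame_der u) Ow0).
apply: eq_fsbigr => w /set_mem Ow.
by rewrite ell_frame_der (der_atP OmegaP w).2.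
Qed.

Lemma model_map_inj : injective model_map.
Proof.
move=> x y /eqP; rewrite -subr_eq0 => /eqP xy.
pose L := GRing.isLinear.Build K W (MA n Omega) *:%R model_map model_map_linear.
pose F : {linear W -> MA n Omega} := HB.pack model_map L.
have {xy} : F (x - y) = 0 by rewrite linearB.
move: (x - y) (subr0_eq (x := x) (y := y)) => z zxy [/= sz z0].
apply: zxy; rewrite (ker_phi_expansion z0) fsbig1 // => w Ow.
suff -> : ell w z = 0 by rewrite scale0r.
have := congr1 (der_eval w) sz; rewrite fsum_additive; last exact: ell_fin_supp.
rewrite linear0 => <-; rewrite -[LHS]mulr1 -[_ * _]/(_ *: (1 : K^o)).
transitivity (\sum_(w' \in Omega) (w == w')%:R *: (ell w' z : K^o)).
  by rewrite (fsum_delta (fun w' => ell w' z : K^o) Ow) [LHS]mulr1.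
apply: eq_fsbigr => w' /set_mem Ow'.
by rewrite /= /der_eval derO_eltE // (der_atP OmegaP w').2 // [LHS]mulrC.
Qed.

(** The traceless part is reached by frame_map u, on which all ell w vanish, and
    der_at Omega w is reached by frame_der u w. *)
Lemma model_map_surj m : exists x, model_map x = m.
Proof.
case: m => m a.
suff [x xm] : exists x, model_map x = (m, 0).
  exists (x + frame_map u a); rewrite -[x]scale1r model_map_linear xm scale1r.
  apply/pair_equal_spec; split => /=; last by rewrite phi_frame add0r.
  by rewrite fsbig1 ?addr0 // => w _; rewrite ell_frame scale0r.
move: m; apply: (@derO_ind _ _ [set m | exists x, model_map x = (m, 0)]).
  split=> [|c m m' [x xm] [y ym]].
    exists 0; rewrite -[0 in LHS](subrr 0) -scaleN1r addrC model_map_linear scaleN1r.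
    exact: addNr.
  exists (c *: x + y); rewrite model_map_linear xm ym; apply/pair_equal_spec.
  by split => //=; rewrite scaler0 addr0.
move=> w Ow; exists (frame_der u w); apply/pair_equal_spec; split => /=.
  rewrite -[RHS](fsum_delta (derO_elt Omega) Ow); apply: eq_fsbigr => w' /set_mem Ow'.
  by rewrite ell_frame_der (der_atP OmegaP w').2.
exact: phi_frame_der.
Qed.

(** On u v lam the first coordinate becomes vg d(g^-1 lam), and Leibniz gives
    vg d(g^-1) lam + v d(lam), where the first term is the trace of
    g d(g^-1) lam v. Both sides being linear, this suffices. *)
Lemma model_map_act (act : W -> SL n K -> W) :
    (forall g a x y, act (a *: x + y) g = a *: act x g + act y g) ->
    (forall g v lam, v *m lam = 0 -> act (u v lam) g = u (v *m g) (invmx g *m lam)) ->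
  forall x g, model_map (act x g) = MA_act (model_map x) g.
Proof.
move=> act_lin act_u x g.
have vg v lam : v *m lam = 0 -> (v *m g) *m (invmx g *m lam) = 0.
  by move=> vl; rewrite mulmxA mulmxK ?SL_unitmx.
have act0 : act 0 g = 0.
  by have := act_lin g (-1) 0 0; rewrite scaleN1r oppr0 addr0 scaleN1r addNr.
have phi_act y : phi (act y g) = adj_act (phi y) g.
  move: y; apply: u_span => [|v lam vl].
    split=> [|a y z /= yE zE].
      have := adj_act_linear g (-1) 0 0; rewrite scaleN1r oppr0 addr0 scaleN1r addNr.
      by rewrite act0 linear0.
    by rewrite act_lin !linearP yE zE adj_act_linear.
  apply: val_inj.
  by rewrite /= act_u // !phiE ?vg //= !pureE ?vg // !mulmxA.
have ell_act w y : ell w (act y g) =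
    ell w y + \tr (g *m map_mx (der_at Omega w) (invmx g) *m phi y).
  move: y; apply: u_span => [|v lam vl].
    split=> [|a y z /= yE zE].
      by rewrite /= act0 linear0 linear0 adj_val0 mulmx0 mxtrace0 addr0.
    rewrite /= act_lin ![ell w (_ + _)]linearP [phi _]linearP adj_val_linear /=.
    rewrite yE zE mulmxDr -scalemxAr mxtraceD mxtraceZ.
    by rewrite -[_ *: _]/(_ * _) -[a *: _]/(_ * _); ring.
  have [dw _] := der_atP OmegaP w.
  rewrite /= act_u // !ellE ?vg // /der_form map_mxM_der // mulmxDr mxE addrC.
  rewrite phiE // pureE //; congr (_ + _).
    by rewrite mulmxA mulmxK ?SL_unitmx.
  by rewrite mxtrace_mulC -!mulmxA mulmxA mxtrace_mulC /mxtrace big_ord1 !mulmxA.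
apply/pair_equal_spec; split=> /=; last exact: phi_act.
(* Written as a linear combination of two coefficient families of finite support. *)
transitivity (\sum_(w \in Omega)
  (1 * ell w x + (ell w (act x g) - ell w x) : K) *: derO_elt Omega w).
  by apply: eq_fsbigr => w _; rewrite mul1r addrC subrK.
rewrite fsum_linear; first last.
- apply: sub_finite_set (fin_suppD (-1) (ell_fin_supp x) (ell_fin_supp (act x g))).
  by move=> w [Ow] /=; rewrite mulN1r addrC.
- exact: ell_fin_supp.
rewrite scale1r; congr (_ + _); apply: eq_fsbigr => w _.
by rewrite ell_act addrC addKr.
Qed.

End Model.

(** * Hyperplanes as columns *)

Section FlagCoordinates.
Variables (n : nat) (K : fieldType).
Local Notation row := 'rV[K]_n.+1.
Local Notation col := 'cV[K]_n.+1.
Local Notation er := (@er n K).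
Local Notation fc := (@fc n K).
Implicit Types (v w : row) (lam mu nu : col) (x y : flag n K).

Definition dot v lam : K := (v *m lam) 0 0.

Lemma dot0P v lam : reflect (v *m lam = 0) (dot v lam == 0).
Proof.
apply: (iffP eqP) => [d0|vl]; last by rewrite /dot vl mxE.
by apply/rowP=> i; rewrite ord1 -[LHS]/(dot v lam) d0 mxE.
Qed.

Lemma dotDl v w lam : dot (v + w) lam = dot v lam + dot w lam.
Proof. by rewrite /dot mulmxDl mxE. Qed.
Lemma dotZl a v lam : dot (a *: v) lam = a * dot v lam.
Proof. by rewrite /dot -scalemxAl mxE. Qed.
Lemma dotDr v lam mu : dot v (lam + mu) = dot v lam + dot v mu.
Proof. by rewrite /dot mulmxDr mxE. Qed.
Lemma dotZr a v lam : dot v (a *: lam) = a * dot v lam.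
Proof. by rewrite /dot -scalemxAr mxE. Qed.

Lemma dot_er i lam : dot (er i) lam = lam i 0.
Proof. by rewrite /dot -rowE mxE. Qed.

Lemma dot_ext lam mu : (forall v, dot v lam = dot v mu) -> lam = mu.
Proof. by move=> H; apply/colP=> i; rewrite -!dot_er. Qed.

Definition hyp lam : {vspace row} := lker (linfun (mulmxr lam : row -> 'M_1)).

Lemma mem_hyp lam v : (v \in hyp lam) = (dot v lam == 0).
Proof.
rewrite memv_ker lfunE /=.
by apply/eqP/dot0P.
Qed.

Lemma exists_dual lam : lam != 0 -> exists v, dot v lam = 1.
Proof.
case/cV0Pn=> i li; exists ((lam i 0)^-1 *: er i).
by rewrite dotZl dot_er mulVf.
Qed.

Lemma dim_hyp lam : lam != 0 -> \dim (hyp lam) = n.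
Proof.
move=> l0; have := limg_ker_dim (linfun (mulmxr lam : row -> 'M_1)) fullv.
rewrite capfv -/(hyp lam) dimvf /dim /= mul1n.
suff -> : \dim (linfun (mulmxr lam : row -> 'M_1) @: fullv) = 1%N.
  by rewrite addn1 => -[].
apply/eqP; rewrite eqn_leq; apply/andP; split.
  by apply: leq_trans (dimvS (subvf _)) _; rewrite dimvf /dim /=.
rewrite lt0n dimv_eq0; have [v vl] := exists_dual l0.
apply/eqP => im0; have := memv_img (linfun (mulmxr lam : row -> 'M_1)) (memvf v).
rewrite im0 memv0 lfunE /= => /eqP/dot0P.
by rewrite vl oner_eq0.
Qed.

Lemma represents_hypP lam (H : {vspace row}) :
  represents_hyp lam H <-> lam != 0 /\ H = hyp lam.
Proof.
split=> [[l0 HP]|[l0 ->]].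
  split=> //; apply/vspaceP=> v; rewrite HP mem_hyp.
  by apply/eqP/dot0P.
split=> // v; rewrite mem_hyp.
by apply/dot0P/eqP.
Qed.

(** A matrix with at most n rows and n + 1 columns has a nonzero column in its
    right kernel. *)
Lemma sub_hyp (U : {vspace row}) : (\dim U <= n)%N ->
  exists2 lam, lam != 0 & (U <= hyp lam)%VS.
Proof.
move=> dU; pose B := \matrix_(i < \dim U) (vbasis U)`_i.
have : kermx B^T != 0.
  rewrite -mxrank_eq0 mxrank_ker -lt0n subn_gt0 mxrank_tr.
  by apply: leq_ltn_trans (rank_leq_row _) _.
rewrite -nz_row_eq0 => nz; exists (nz_row (kermx B^T))^T.
  by rewrite trmx_eq0.
have BK : B *m (nz_row (kermx B^T))^T = 0.
  apply: trmx_inj; rewrite trmx_mul trmxK trmx0.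
  by apply/sub_kermxP; exact: nz_row_sub.
rewrite -[X in (X <= _)%VS](span_basis (vbasisP U)); apply/span_subvP => v /(nthP 0)[i].
rewrite size_tuple => iU <-; rewrite mem_hyp; apply/dot0P.
have /row_matrixP/(_ (Ordinal iU)) := BK.
by rewrite row_mul rowK row0.
Qed.

Lemma exists_represents_hyp (H : {vspace row}) : \dim H = n ->
  exists lam, represents_hyp lam H.
Proof.
move=> dH; have [lam l0 Hl] := sub_hyp (eq_leq dH).
exists lam; apply/represents_hypP; split=> //; apply/eqP.
by rewrite eqEdim Hl dim_hyp // dH /=.
Qed.

Lemma hyp_sub lam mu : lam != 0 -> (hyp lam <= hyp mu)%VS -> exists a, mu = a *: lam.
Proof.
move=> l0 /subvP sub; have [w wl] := exists_dual l0.
exists (dot w mu); apply: dot_ext => v.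
have : v - dot v lam *: w \in hyp mu.
  by apply: sub; rewrite mem_hyp -scaleNr dotDl dotZl wl mulr1 subrr.
rewrite mem_hyp -scaleNr dotDl dotZl mulNr subr_eq0 => /eqP ->.
by rewrite dotZr mulrC.
Qed.

Lemma lin_indep2P (V : lmodType K) (u u' : V) : u != 0 ->
  lin_indep2 u u' \/ exists a, u' = a *: u.
Proof.
move=> u0; have [[a ->]|H] := pselect (exists a, u' = a *: u).
  by right; exists a.
left=> a b /eqP; have [->|b0] := eqVneq b 0.
  by rewrite scale0r addr0 scaler_eq0 (negPf u0) orbF => /eqP ->.
rewrite addrC addr_eq0 => /eqP e; case: H; exists (- (b^-1 * a)).
by rewrite scaleNr -scalerA -scalerN -e scalerA mulVf // scale1r.
Qed.

Lemma lin_indep2_sym (V : lmodType K) (u u' : V) : lin_indep2 u u' -> lin_indep2 u' u.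
Proof. by move=> H a b; rewrite addrC => /H[]. Qed.

Lemma lin_indep2_neq0 (V : lmodType K) (u u' : V) : lin_indep2 u u' -> u != 0.
Proof.
move=> H; apply/eqP => u0; have [] := H 1 0.
  by rewrite u0 scaler0 scale0r addr0.
by move/eqP; rewrite oner_eq0.
Qed.

Lemma lin_indep2_notin (V : lmodType K) (u u' : V) a : lin_indep2 u u' -> u' <> a *: u.
Proof.
move=> H e; have [] := H a (-1); first by rewrite e scaleN1r subrr.
by move=> _ /eqP; rewrite oppr_eq0 oner_eq0.
Qed.

Lemma exists_dual2 lam mu : lin_indep2 lam mu ->
  exists w, dot w lam = 1 /\ dot w mu = 0.
Proof.
move=> ind; have m0 := lin_indep2_neq0 (lin_indep2_sym ind).
have /subvPn[w wm wl] : ~~ (hyp mu <= hyp lam)%VS.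
  by apply/negP=> /(hyp_sub m0)[a]; apply: lin_indep2_notin; exact: lin_indep2_sym.
rewrite !mem_hyp in wm wl; exists ((dot w lam)^-1 *: w).
by rewrite !dotZl (eqP wm) mulr0 mulVf.
Qed.

(** With rows w, z dual to lam, mu, subtracting from v its components along w and
    z moves it into both hyperplanes, so nu = nu(w) lam + nu(z) mu. *)
Lemma cap_hyp_sub lam mu nu : lin_indep2 lam mu ->
  (hyp lam :&: hyp mu <= hyp nu)%VS -> exists a b, nu = a *: lam + b *: mu.
Proof.
move=> ind /subvP sub; have [w [wl wm]] := exists_dual2 ind.
have [z [zm zl]] := exists_dual2 (lin_indep2_sym ind).
exists (dot w nu), (dot z nu); apply: dot_ext => v.
have : v + (- dot v lam *: w + - dot v mu *: z) \in hyp nu.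
  apply: sub; rewrite memv_cap !mem_hyp !dotDl !dotZl wl wm zl zm.
  by rewrite !mulr0 !mulr1 addr0 add0r !addrN eqxx.
rewrite mem_hyp !dotDl !dotZl dotDr !dotZr !mulNr -opprD subr_eq0 => /eqP ->.
by rewrite mulrC [X in _ + X]mulrC.
Qed.

Lemma dim_cap_hyp lam mu : lin_indep2 lam mu ->
  (\dim (hyp lam :&: hyp mu)).+1 = n.
Proof.
move=> ind; have l0 := lin_indep2_neq0 ind.
have m0 := lin_indep2_neq0 (lin_indep2_sym ind).
have := dimv_sum_cap (hyp lam) (hyp mu); rewrite !dim_hyp //.
suff -> : \dim (hyp lam + hyp mu) = n.+1 by rewrite addSnnS => /addnI.
apply/eqP; rewrite eqn_leq; apply/andP; split.
  by apply: leq_trans (dimvS (subvf _)) _; rewrite dimvf /dim /= mul1n.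
have [w [wl wm]] := exists_dual2 ind.
rewrite -[X in (X < _)%N](dim_hyp l0) ltn_neqAle dimvS ?addvSl // andbT.
apply/eqP => e.
have e' : hyp lam = (hyp lam + hyp mu)%VS.
  by apply/eqP; rewrite eqEdim addvSl e /=.
have : w \in hyp lam.
  by rewrite e'; apply: subvP (addvSr _ _) _ _; rewrite mem_hyp wm.
by rewrite mem_hyp wl oner_eq0.
Qed.

Lemma cap_hyp_neq0 lam mu : (1 < n)%N -> lam != 0 -> mu != 0 ->
  exists z : row, [/\ z != 0, z *m lam = 0 & z *m mu = 0].
Proof.
move=> n1 l0 m0; have : (hyp lam :&: hyp mu)%VS != 0%VS.
  rewrite -dimv_eq0 -lt0n -(ltn_add2l (\dim (hyp lam + hyp mu))) addn0.
  rewrite dimv_sum_cap !dim_hyp //; apply: leq_ltn_trans (dimvS (subvf _)) _.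
  by rewrite dimvf /dim /= mul1n -addn1 ltn_add2l.
rewrite -vpick0 => nz; exists (vpick (hyp lam :&: hyp mu)%VS).
have := memv_pick (hyp lam :&: hyp mu)%VS.
by rewrite memv_cap !mem_hyp => /andP[/dot0P ? /dot0P ?].
Qed.

Lemma exists_indep_row lam v : (1 < n)%N -> lam != 0 -> v != 0 ->
  exists z : row, z *m lam = 0 /\ lin_indep2 v z.
Proof.
move=> n1 l0 v0; have /subvPn[z zl zv] : ~~ (hyp lam <= <[v]>)%VS.
  by apply/negP=> /dimvS; rewrite dim_hyp // dim_vline v0 leqNgt n1.
exists z; split; first by apply/dot0P; rewrite -mem_hyp.
have [//|[a za]] := lin_indep2P z v0.
by case/negP: zv; apply/vlineP; exists a.
Qed.

End FlagCoordinates.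

(** * Flags and lines of the geometry in coordinates *)

Section FlagVectors.
Variables (n : nat) (K : fieldType).
Local Notation row := 'rV[K]_n.+1.
Local Notation col := 'cV[K]_n.+1.
Implicit Types (v w : row) (lam mu nu : col) (x y : flag n K).

Definition flag_rep x v lam : Prop :=
  represents_point v (fpt x) /\ represents_hyp lam (fhyp x).

Lemma flag_ext x y : fpt x = fpt y -> fhyp x = fhyp y -> x = y.
Proof.
case: x y => [p H xP] [p' H' yP] /= ep eH; subst p' H'.
by congr Flag; exact: bool_irrelevance.
Qed.

Lemma flag_repP x v lam :
  flag_rep x v lam <-> [/\ v != 0, lam != 0, fpt x = <[v]>%VS & fhyp x = hyp lam].
Proof.
split=> [[[v0 xv] /represents_hypP[l0 xl]] //|[v0 l0 xv xl]].
by split=> //; apply/represents_hypP.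
Qed.

Lemma flag_rep_neq0 x v lam : flag_rep x v lam -> v != 0 /\ lam != 0.
Proof. by move=> /flag_repP[]. Qed.

Lemma flag_rep_orth x v lam : flag_rep x v lam -> v *m lam = 0.
Proof.
move=> /flag_repP[_ _ xv xl]; have /and3P[_ _] := flagP x.
by rewrite xv xl => /subvP/(_ v (memv_line v)); rewrite mem_hyp => /dot0P.
Qed.

Lemma exists_flag_rep x : exists v lam, flag_rep x v lam.
Proof.
have /and3P[dp /eqP dH _] := flagP x.
have [lam lP] := exists_represents_hyp dH.
exists (vpick (fpt x)), lam; split=> //; split.
  by rewrite vpick0 -dimv_eq0 (eqP dp).
apply/esym/eqP; rewrite eqEdim -memvE memv_pick /= (eqP dp) dim_vline.
by rewrite vpick0 -dimv_eq0 (eqP dp).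
Qed.

Lemma exists_flag v lam : v != 0 -> lam != 0 -> v *m lam = 0 ->
  exists x, flag_rep x v lam.
Proof.
move=> v0 l0 vl.
have xP : [&& \dim <[v]>%VS == 1%N, \dim (hyp lam) == n & (<[v]> <= hyp lam)%VS].
  by rewrite dim_vline v0 dim_hyp // !eqxx -memvE mem_hyp; apply/dot0P.
by exists (Flag xP); apply/flag_repP.
Qed.

Lemma flag_rep_inj x y v lam : flag_rep x v lam -> flag_rep y v lam -> x = y.
Proof.
move=> /flag_repP[_ _ xv xl] /flag_repP[_ _ yv yl].
by apply: flag_ext; rewrite ?xv ?xl.
Qed.

Lemma vline_eqZ v w : v != 0 -> <[v]>%VS = <[w]>%VS -> exists2 a, a != 0 & v = a *: w.
Proof.
move=> v0 vw; have /vlineP[a va] : v \in <[w]>%VS by rewrite -vw memv_line.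
by exists a => //; apply: contraNneq v0 => a0; rewrite va a0 scale0r.
Qed.

Lemma vlineZ a v : a != 0 -> <[a *: v]>%VS = <[v]>%VS.
Proof.
move=> a0; apply/vspaceP=> w; apply/vlineP/vlineP=> -[k ->].
  by exists (k * a); rewrite scalerA.
by exists (k / a); rewrite scalerA divfK.
Qed.

Lemma hypZ a lam : a != 0 -> hyp (a *: lam) = hyp lam.
Proof. by move=> a0; apply/vspaceP=> v; rewrite !mem_hyp dotZr mulf_eq0 (negPf a0). Qed.

Lemma flag_repZ x a b v lam : a != 0 -> b != 0 ->
  flag_rep x v lam -> flag_rep x (a *: v) (b *: lam).
Proof.
move=> a0 b0 /flag_repP[v0 l0 xv xl]; apply/flag_repP; split.
- by rewrite scaler_eq0 negb_or a0.
- by rewrite scaler_eq0 negb_or b0.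
- by rewrite vlineZ.
- by rewrite hypZ.
Qed.

Lemma flag_rep_unique x v lam w mu : flag_rep x v lam -> flag_rep x w mu ->
  exists a b, [/\ a != 0, b != 0, w = a *: v & mu = b *: lam].
Proof.
move=> /flag_repP[v0 l0 xv xl] /flag_repP[w0 m0 xw xm].
have [a a0 wa] : exists2 a, a != 0 & w = a *: v by apply: vline_eqZ; rewrite // -xw.
have [b mb] : exists b, mu = b *: lam by apply: hyp_sub; rewrite // -xl xm.
exists a, b; split=> //; apply: contraNneq m0 => b0.
by rewrite mb b0 scale0r.
Qed.

Lemma flag_rep_act x v lam (g : SL n K) : flag_rep x v lam ->
  flag_rep (flag_act x g) (v *m g) (invmx g *m lam).
Proof.
move=> /flag_repP[v0 l0 xv xl].
have gK p (w : 'M_(p, n.+1)) : w *m g *m invmx g = w by rewrite mulmxK ?SL_unitmx.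
have gKV p (mu : 'M_(n.+1, p)) : (g : 'M_n.+1) *m (invmx g *m mu) = mu.
  by rewrite mulmxA mulmxV ?SL_unitmx // mul1mx.
apply/flag_repP; split.
- by apply: contraNneq v0 => vg; rewrite -(gK _ v) vg mul0mx.
- by apply: contraNneq l0 => gl; rewrite -(gKV _ lam) gl mulmx0.
- by rewrite /= xv /vact limg_line lfunE.
apply/vspaceP=> w; rewrite /= xl mem_hyp /dot mulmxA -/(dot _ _) -mem_hyp.
apply/memv_imgP/idP => [[z zl ->]|wl]; first by rewrite lfunE /= gK.
by exists (w *m invmx g); rewrite // lfunE /= mulmxKV ?SL_unitmx.
Qed.

Definition hyp_pencil v lam mu : set (flag n K) :=
  [set x | exists a b, flag_rep x v (a *: lam + b *: mu)].

Definition point_range v w lam : set (flag n K) :=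
  [set x | exists a b, flag_rep x (a *: v + b *: w) lam].

Lemma line_pSE v lam mu : v != 0 -> lin_indep2 lam mu ->
  line_pS <[v]>%VS (hyp lam :&: hyp mu)%VS = hyp_pencil v lam mu.
Proof.
move=> v0 ind; apply/seteqP; split=> x /=; last first.
  move=> [a [b /flag_repP[_ _ xv xl]]]; split=> //; rewrite xl.
  apply/subvP=> z; rewrite memv_cap !mem_hyp => /andP[/eqP zl /eqP zm].
  by rewrite dotDr !dotZr zl zm !mulr0 addr0.
move=> [xv Sx]; have [w [nu xr]] := exists_flag_rep x.
have /flag_repP[_ nu0 _ xnu] := xr.
have [|a [b nuE]] := @cap_hyp_sub _ _ _ _ nu ind; first by rewrite -xnu.
by exists a, b; rewrite -nuE; apply/flag_repP.
Qed.

Lemma line_LHE v w lam : lam != 0 ->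
  line_LH (<[v]> + <[w]>)%VS (hyp lam) = point_range v w lam.
Proof.
move=> l0; apply/seteqP; split=> x /=; last first.
  move=> [a [b /flag_repP[_ _ xv xl]]]; split=> //; rewrite xv.
  by rewrite -memvE; apply: memv_add; apply/vlineP; eexists.
move=> [xL xl]; have [z [nu /flag_repP[z0 _ xz _]]] := exists_flag_rep x.
have : z \in (<[v]> + <[w]>)%VS by apply: subvP xL _ _; rewrite xz memv_line.
move=> /memv_addP[_ /vlineP[a ->] [_ /vlineP[b ->]]] zE.
by exists a, b; apply/flag_repP; rewrite -zE.
Qed.

Lemma dim_vline2 (vT : vectType K) (v w : vT) :
  lin_indep2 v w -> \dim (<[v]> + <[w]>) = 2%N.
Proof.
move=> ind; have v0 := lin_indep2_neq0 ind.
have w0 := lin_indep2_neq0 (lin_indep2_sym ind).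
rewrite dimv_disjoint_sum ?dim_vline ?v0 ?w0 //.
apply/eqP; rewrite -subv0; apply/subvP => z; rewrite memv_cap memv0.
move=> /andP[/vlineP[a ->] /vlineP[b e]].
have [|-> _] := ind a (- b); first by rewrite e scaleNr subrr.
by rewrite scale0r.
Qed.

Lemma family1P (l : set (flag n K)) : family1 l <-> exists v lam mu,
  [/\ v != 0, lin_indep2 lam mu, v *m lam = 0, v *m mu = 0
    & l = hyp_pencil v lam mu].
Proof.
split=> [[p [S [dp dS pS ->]]]|[v [lam [mu [v0 ind vl vm ->]]]]]; last first.
  exists <[v]>%VS, (hyp lam :&: hyp mu)%VS; split.
  - by rewrite dim_vline v0.
  - by rewrite dim_cap_hyp.
  - by rewrite -memvE memv_cap !mem_hyp; apply/andP; split; apply/dot0P.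
  - by rewrite line_pSE.
have dS' : (\dim S).+1 = n by case: dS.
have pv0 : vpick p != 0 by rewrite vpick0 -dimv_eq0 dp.
have pE : p = <[vpick p]>%VS.
  by apply/esym/eqP; rewrite eqEdim -memvE memv_pick /= dp dim_vline pv0.
have [lam l0 Sl] : exists2 lam, lam != 0 & (S <= hyp lam)%VS.
  by apply: sub_hyp; apply: ltnW; rewrite dS'.
have [w wl] := exists_dual l0.
have [mu m0 Sm] : exists2 mu, mu != 0 & (S + <[w]> <= hyp mu)%VS.
  apply: sub_hyp; apply: leq_trans (dimv_add_leqif _ _) _.
  rewrite dim_vline; apply: leq_trans (eq_leq dS').
  by rewrite -[(\dim S).+1]addn1 leq_add2l; case: (w != 0).
move: Sm; rewrite subv_add -memvE mem_hyp => /andP[Sm /eqP wm].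
(* The row w lies in hyp mu but not in hyp lam. *)
have ind : lin_indep2 lam mu.
  move=> a b e; have := congr1 (dot w) e; rewrite dotDr !dotZr wl wm mulr0 addr0 mulr1.
  rewrite {1}/dot mulmx0 mxE => a0; split=> //; move/eqP: e.
  by rewrite a0 scale0r add0r scaler_eq0 (negPf m0) orbF => /eqP.
have SE : S = (hyp lam :&: hyp mu)%VS.
  apply/eqP; rewrite eqEdim subv_cap Sl Sm /= -ltnS dim_cap_hyp //.
  by rewrite dS'.
exists (vpick p), lam, mu; split=> //; last by rewrite -line_pSE // -pE -SE.
  apply/dot0P; rewrite -mem_hyp; apply: subvP Sl _ _.
  by apply: subvP pS _ _; exact: memv_pick.
apply/dot0P; rewrite -mem_hyp; apply: subvP Sm _ _.
by apply: subvP pS _ _; exact: memv_pick.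
Qed.

Lemma family2P (l : set (flag n K)) : family2 l <-> exists v w lam,
  [/\ lin_indep2 v w, lam != 0, v *m lam = 0, w *m lam = 0 & l = point_range v w lam].
Proof.
split=> [[L [H [dL dH LH ->]]]|[v [w [lam [ind l0 vl wl ->]]]]]; last first.
  exists (<[v]> + <[w]>)%VS, (hyp lam); split.
  - exact: dim_vline2.
  - exact: dim_hyp.
  - by rewrite subv_add -!memvE !mem_hyp; apply/andP; split; apply/dot0P.
  - by rewrite line_LHE.
have [lam /represents_hypP[l0 HE]] := exists_represents_hyp dH.
have v0 : vpick L != 0 by rewrite vpick0 -dimv_eq0 dL.
have /subvPn[w wL wv] : ~~ (L <= <[vpick L]>)%VS.
  by apply/negP=> /dimvS; rewrite dL dim_vline v0.
have ind : lin_indep2 (vpick L) w.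
  have [//|[a wE]] := lin_indep2P w v0.
  by case/negP: wv; apply/vlineP; exists a.
have LE : L = (<[vpick L]> + <[w]>)%VS.
  apply/esym/eqP; rewrite eqEdim subv_add -!memvE memv_pick wL /=.
  by rewrite dL dim_vline2.
exists (vpick L), w, lam; split=> //; last by rewrite -line_LHE // -LE HE.
  by apply/dot0P; rewrite -mem_hyp -HE; apply: subvP LH _ _; exact: memv_pick.
by apply/dot0P; rewrite -mem_hyp -HE; apply: subvP LH _ _.
Qed.

End FlagVectors.

(** * Embeddings given by a vector above each flag *)

Section Rays.
Variables (K : fieldType).

Lemma ray_self (V : lmodType K) (u : V) : ray u u.
Proof. by exists 1; rewrite scale1r. Qed.

Lemma rayZ (V : lmodType K) (u : V) a : a != 0 -> ray (a *: u) = ray u.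
Proof.
move=> a0; apply/seteqP; split=> w [b ->].
  by exists (b * a); rewrite scalerA.
by exists (b / a); rewrite scalerA divfK.
Qed.

Lemma ray_eq (V : lmodType K) (u w : V) : ray u w -> w != 0 -> ray u = ray w.
Proof.
move=> [a ->] w0; rewrite rayZ //; apply: contraNneq w0 => ->.
by rewrite scale0r.
Qed.

Lemma image_ray (V W : lmodType K) (s : {rmorphism K -> K}) (f : V -> W) u :
  is_semilinear s f -> f @` ray u = ray (f u).
Proof.
move=> [[t st ts] fD fZ]; apply/seteqP; split=> [_ [_ [a ->] <-]|_ [a ->]].
  by exists (s a); rewrite fZ.
by exists (t a *: u); [exists (t a)|rewrite fZ ts].
Qed.

Lemma semilinear0 (V W : lmodType K) (s : {rmorphism K -> K}) (f : V -> W) :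
  is_semilinear s f -> f 0 = 0.
Proof. by move=> [_ _ fZ]; rewrite -(scale0r 0) fZ rmorph0 scale0r. Qed.

Lemma lin_indep2_image (V W : lmodType K) (s : {rmorphism K -> K}) (f : V -> W) u w :
  is_semilinear s f -> lin_indep2 (f u) (f w) -> lin_indep2 u w.
Proof.
move=> fs ind a b e; have [_ fD fZ] := fs.
have := congr1 f e; rewrite (semilinear0 fs) fD !fZ => /ind[sa sb].
by split; apply/eqP; rewrite -(fmorph_eq0 s) ?sa ?sb.
Qed.

Lemma lin_span2_exchange (V : lmodType K) (a b u w : V) : lin_indep2 u w ->
  lin_span [set a; b] u -> lin_span [set a; b] w ->
  lin_span [set a; b] `<=` lin_span [set u; w].
Proof.
move=> ind /lin_span2P[u1 [u2 uE]] /lin_span2P[w1 [w2 wE]].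
set D := u1 * w2 - u2 * w1.
have aE : w2 *: u - u2 *: w = D *: a.
  rewrite uE wE !scalerDr !scalerA opprD addrACA [w2 * u2]mulrC subrr addr0.
  by rewrite -scalerBl [w2 * _]mulrC.
have bE : u1 *: w - w1 *: u = D *: b.
  rewrite uE wE !scalerDr !scalerA opprD addrACA [w1 * u1]mulrC subrr add0r.
  by rewrite -scalerBl [w1 * _]mulrC.
have D0 : D != 0.
  apply/eqP => D0; have [|w20 u20] := ind w2 (- u2).
    by rewrite scaleNr aE D0 scale0r.
  have [|w10 _] := ind (- w1) u1.
    by rewrite addrC scaleNr bE D0 scale0r.
  have /eqP := lin_indep2_neq0 (lin_indep2_sym ind); apply.
  move/eqP: w10; rewrite oppr_eq0 => /eqP w10.
  by rewrite wE w20 w10 !scale0r addr0.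
apply: lin_span_min; first exact: lin_span_closed.
move=> z [->|->]; apply/lin_span2P.
  exists (D^-1 * w2), (- (D^-1 * u2)).
  by rewrite scaleNr -!scalerA -scalerBr aE scalerA mulVf // scale1r.
exists (- (D^-1 * w1)), (D^-1 * u1).
by rewrite addrC scaleNr -!scalerA -scalerBr bE scalerA mulVf // scale1r.
Qed.

End Rays.

Section VectorEmbedding.
Variables (n : nat) (K : fieldType).
Local Notation row := 'rV[K]_n.+1.
Local Notation col := 'cV[K]_n.+1.
Implicit Types (v w : row) (lam mu : col) (x y : flag n K).

Lemma col_row_eq0 lam v : lam *m v = 0 -> lam != 0 -> v = 0.
Proof.
move=> lv /cV0Pn[i li]; apply/rowP=> j; have /matrixP/(_ i j) := lv.
by rewrite !mxE big_ord1 => /eqP; rewrite mulf_eq0 (negPf li) => /eqP.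
Qed.

Lemma row_col_eq0 lam v : lam *m v = 0 -> v != 0 -> lam = 0.
Proof.
move=> /(congr1 trmx); rewrite trmx_mul trmx0 => vl v0.
apply/colP=> i; have /rV0Pn[j vj] := v0; have /matrixP/(_ j i) := vl.
by rewrite !mxE big_ord1 !mxE => /eqP; rewrite mulf_eq0 (negPf vj) => /eqP.
Qed.

Lemma pure_indep_rows v w lam : lin_indep2 v w -> lam != 0 ->
  v *m lam = 0 -> w *m lam = 0 -> lin_indep2 (pure lam v) (pure lam w).
Proof.
move=> ind l0 vl wl a b e; apply: ind.
have pb := @pure_bilinear n K; have o : (a *: v) *m lam = 0.
  by rewrite -scalemxAl vl scaler0.
have ob : (b *: w) *m lam = 0 by rewrite -scalemxAl wl scaler0.
have := e; rewrite -[a *: _](fbZl pb) // -[b *: _](fbZl pb) // -(fbDl pb) //.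
move=> /(congr1 (@adj_val n K)); rewrite adj_val0 /pure_form pureE => [z|].
  exact: col_row_eq0 z l0.
by rewrite mulmxDl o ob addr0.
Qed.

Lemma pure_indep_cols v lam mu : lin_indep2 lam mu -> v != 0 ->
  v *m lam = 0 -> v *m mu = 0 -> lin_indep2 (pure lam v) (pure mu v).
Proof.
move=> ind v0 vl vm a b e; apply: ind.
have pb := @pure_bilinear n K; have o : v *m (a *: lam) = 0.
  by rewrite -scalemxAr vl scaler0.
have ob : v *m (b *: mu) = 0 by rewrite -scalemxAr vm scaler0.
have := e; rewrite -[a *: _](fbZr pb) // -[b *: _](fbZr pb) // -(fbDr pb) //.
move=> /(congr1 (@adj_val n K)); rewrite adj_val0 /pure_form pureE => [z|].
  exact: row_col_eq0 z v0.
by rewrite mulmxDr o ob addr0.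
Qed.

Lemma pure_neq0 v lam : v != 0 -> lam != 0 -> v *m lam = 0 -> pure lam v != 0.
Proof.
move=> v0 l0 vl; apply: contraNneq v0 => /(congr1 (@adj_val n K)).
by rewrite adj_val0 pureE // => /col_row_eq0/(_ l0) ->.
Qed.

Definition vec_map (Q : lmodType K) (q : row -> col -> Q) (x : flag n K) : set Q :=
  [set a | exists v lam, [/\ represents_point v (fpt x),
                            represents_hyp lam (fhyp x) & ray (q v lam) a]].

Lemma vec_mapE (Q : lmodType K) (q : row -> col -> Q) x v lam :
  flag_bilinear q -> flag_rep x v lam -> vec_map q x = ray (q v lam).
Proof.
move=> qb xr; have vl := flag_rep_orth xr; apply/seteqP; split=> z; last first.
  by move=> zr; have [xv xl] := xr; exists v, lam.
move=> [w [mu [xw xm]]].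
have [a [b [a0 b0 -> ->]]] := flag_rep_unique xr (conj xw xm : flag_rep x w mu).
by rewrite (fbZl qb) ?(fbZr qb) -?scalemxAr ?vl ?scaler0 // scalerA rayZ // mulf_neq0.
Qed.

Lemma eps_natE x v lam : flag_rep x v lam -> eps_nat x = ray (pure lam v).
Proof. exact: (vec_mapE (@pure_bilinear n K)). Qed.

(** A nonzero matrix of rank one determines its row and its column up to
    scalars. *)
Lemma eps_nat_inj : injective (@eps_nat n K).
Proof.
move=> x y; have [v [lam xr]] := exists_flag_rep x.
have [w [mu yr]] := exists_flag_rep y.
rewrite (eps_natE xr) (eps_natE yr) => e.
have [v0 l0] := flag_rep_neq0 xr; have vl := flag_rep_orth xr.
have wm := flag_rep_orth yr.
have : ray (pure mu w) (pure lam v) by rewrite -e; exact: ray_self.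
move=> [a /(congr1 (@adj_val n K))].
rewrite pureE // -[a *: _]addr0 adj_val_linear adj_val0 addr0 pureE // => lv.
have ent i j : lam i 0 * v 0 j = a * (mu i 0 * w 0 j).
  by have /matrixP/(_ i j) := lv; rewrite !mxE !big_ord1.
have [i li] := cV0Pn _ l0; have [j vj] := rV0Pn _ v0.
have [c vE] : exists c, v = c *: w.
  exists ((lam i 0)^-1 * a * mu i 0).
  by apply/rowP=> k; rewrite mxE -[LHS](mulKf li) ent; ring.
have [d lE] : exists d, lam = d *: mu.
  exists ((v 0 j)^-1 * a * w 0 j).
  by apply/colP=> k; rewrite mxE -[LHS](mulKf vj) [v 0 j * _]mulrC ent; ring.
apply: flag_rep_inj xr _; rewrite vE lE; apply: flag_repZ yr.
  by apply: contraNneq v0 => c0; rewrite vE c0 scale0r.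
by apply: contraNneq l0 => d0; rewrite lE d0 scale0r.
Qed.

(** A map bilinear on orthogonal pairs whose values lie above those of the
    natural embedding sends lines onto lines: the vectors above two points of a
    line are independent because their images in the adjoint module are. *)
Section Criterion.
Variables (Q : lmodType K) (q : row -> col -> Q) (pi : {linear Q -> adjoint n K}).
Hypothesis qb : flag_bilinear q.
Hypothesis piE : forall v lam, v *m lam = 0 -> pi (q v lam) = pure lam v.

Lemma id_semilinear : is_semilinear (idfun : {rmorphism K -> K}) pi.
Proof.
split=> [|u w|a u]; [by exists id|by rewrite linearD|by rewrite linearZ].
Qed.

Lemma vec_map_projection :
  @is_projection K (A1n n K) _ _ (vec_map q) (@eps_nat n K) idfun pi.
Proof.
split=> [|x]; first exact: id_semilinear.
have [v [lam xr]] := exists_flag_rep x.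
rewrite (eps_natE xr) (vec_mapE qb xr) (image_ray _ id_semilinear) piE //.
exact: flag_rep_orth xr.
Qed.

Lemma lin_indep2_lift (u w : Q) : lin_indep2 (pi u) (pi w) -> lin_indep2 u w.
Proof. exact: lin_indep2_image id_semilinear. Qed.

Lemma q_neq0 x v lam : flag_rep x v lam -> q v lam != 0.
Proof.
move=> xr; have [v0 l0] := flag_rep_neq0 xr; have vl := flag_rep_orth xr.
by apply: contraNneq (pure_neq0 v0 l0 vl) => q0; rewrite -piE // q0 linear0.
Qed.

Lemma vec_map_pline (l : set (flag n K)) (u w : Q) : lin_indep2 u w ->
  (forall x, l x -> exists a b, vec_map q x = ray (a *: u + b *: w)) ->
  (forall a b, a *: u + b *: w != 0 ->
     exists2 x, l x & vec_map q x = ray (a *: u + b *: w)) ->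
  is_pline (vec_map q @` l).
Proof.
move=> ind lq ql; exists u, w; split=> //; apply/seteqP; split=> P.
  move=> [x lx <-]; have [a [b e]] := lq x lx; split.
    have [v [lam xr]] := exists_flag_rep x.
    by rewrite (vec_mapE qb xr); exists (q v lam); rewrite // (q_neq0 xr).
  rewrite e => _ [c ->]; apply/lin_span2P; exists (c * a), (c * b).
  by rewrite scalerDr !scalerA.
move=> [[z z0 ->] sub]; have /lin_span2P[a [b zE]] := sub _ (ray_self z).
have [|x lx xE] := ql a b; first by rewrite -zE.
by exists x => //; rewrite xE zE.
Qed.

Lemma vec_map_embedding :
  (forall N : set Q, lin_closed N ->
     (forall v lam, v *m lam = 0 -> N (q v lam)) -> forall z, N z) ->
  @is_embedding K (A1n n K) Q (vec_map q).
Proof.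
move=> q_span; split=> [x|x y e|l|].
- have [v [lam xr]] := exists_flag_rep x.
  by exists (q v lam); [exact: q_neq0 xr|exact: vec_mapE].
- by have [_ pe] := vec_map_projection; apply: eps_nat_inj; rewrite !pe e.
- move=> [/family1P[v [lam [mu [v0 ind vl vm ->]]]]|].
    apply: (@vec_map_pline _ (q v lam) (q v mu)).
    + by apply: lin_indep2_lift; rewrite !piE //; exact: pure_indep_cols.
    + move=> x [a [b xr]]; exists a, b.
      rewrite (vec_mapE qb xr) (fbDr qb) ?(fbZr qb) //.
        by rewrite -scalemxAr vl scaler0.
      by rewrite -scalemxAr vm scaler0.
    move=> a b nz; have o : v *m (a *: lam + b *: mu) = 0.
      by rewrite mulmxDr -!scalemxAr vl vm !scaler0 addr0.
    have qE : a *: q v lam + b *: q v mu = q v (a *: lam + b *: mu).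
      rewrite (fbDr qb) ?(fbZr qb) //; first by rewrite -scalemxAr vl scaler0.
      by rewrite -scalemxAr vm scaler0.
    have [|x xr] := exists_flag v0 _ o.
      by apply: contraNneq nz => ab0; rewrite qE ab0 (fb0r qb).
    by exists x; [exists a, b|rewrite qE; exact: vec_mapE].
  move=> /family2P[v [w [lam [ind l0 vl wl ->]]]].
  apply: (@vec_map_pline _ (q v lam) (q w lam)).
  + by apply: lin_indep2_lift; rewrite !piE //; exact: pure_indep_rows.
  + move=> x [a [b xr]]; exists a, b.
    rewrite (vec_mapE qb xr) (fbDl qb) ?(fbZl qb) //.
      by rewrite -scalemxAl vl scaler0.
    by rewrite -scalemxAl wl scaler0.
  move=> a b nz; have o : (a *: v + b *: w) *m lam = 0.
    by rewrite mulmxDl -!scalemxAl vl wl !scaler0 addr0.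
  have qE : a *: q v lam + b *: q w lam = q (a *: v + b *: w) lam.
    rewrite (fbDl qb) ?(fbZl qb) //; first by rewrite -scalemxAl vl scaler0.
    by rewrite -scalemxAl wl scaler0.
  have [|x xr] := exists_flag _ l0 o.
    by apply: contraNneq nz => ab0; rewrite qE ab0 (fb0l qb).
  by exists x; [exists a, b|rewrite qE; exact: vec_mapE].
apply/seteqP; split=> // z _; move: z; apply: q_span; first exact: lin_span_closed.
move=> v lam vl; have [->|v0] := eqVneq v 0.
  by rewrite (fb0l qb); exact: (lin_span_closed _).1.
have [->|l0] := eqVneq lam 0.
  by rewrite (fb0r qb); exact: (lin_span_closed _).1.
have [x xr] := exists_flag v0 l0 vl.
apply: sub_lin_span; exists x => //.
by rewrite (vec_mapE qb xr); exact: ray_self.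
Qed.
End Criterion.

End VectorEmbedding.

(** * Normalising scalars *)

(** If r is a multiple of q flag by flag, additivity forces the same factor on
    flags that differ by an independent point of a line. Two flags (v, lam),
    (w, mu) are joined through (z, lam) and (z, mu), where z is a common point
    of the two hyperplanes. *)
Section Proportional.
Variables (n : nat) (K : fieldType) (n_gt1 : (1 < n)%N).
Local Notation row := 'rV[K]_n.+1.
Local Notation col := 'cV[K]_n.+1.
Variables (Q : lmodType K) (q r : row -> col -> Q) (qb : flag_bilinear q).
Hypothesis rDl : forall v w lam, v *m lam = 0 -> w *m lam = 0 ->
  r (v + w) lam = r v lam + r w lam.
Hypothesis rDr : forall v lam mu, v *m lam = 0 -> v *m mu = 0 ->
  r v (lam + mu) = r v lam + r v mu.
Hypothesis q_indl : forall v w lam, lin_indep2 v w -> lam != 0 ->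
  v *m lam = 0 -> w *m lam = 0 -> lin_indep2 (q v lam) (q w lam).
Hypothesis q_indr : forall v lam mu, lin_indep2 lam mu -> v != 0 ->
  v *m lam = 0 -> v *m mu = 0 -> lin_indep2 (q v lam) (q v mu).
Variable c : row -> col -> K.
Hypothesis rE : forall v lam, v != 0 -> lam != 0 -> v *m lam = 0 ->
  r v lam = c v lam *: q v lam.

Lemma indep_coef (V : lmodType K) (x y : V) (a b d : K) : lin_indep2 x y ->
  a *: (x + y) = b *: x + d *: y -> b = d.
Proof.
move=> ind e; have [|/subr0_eq <- /subr0_eq //] := ind (a - b) (a - d).
by rewrite !scalerBl addrACA -opprD -e scalerDr subrr.
Qed.

Lemma indep_add_neq0 (V : lmodType K) (x y : V) : lin_indep2 x y -> x + y != 0.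
Proof.
move=> ind; apply/eqP => e; have [|/eqP] := ind 1 1; first by rewrite !scale1r.
by rewrite oner_eq0.
Qed.

Let constl v w lam : lam != 0 -> v *m lam = 0 -> w *m lam = 0 -> v != 0 -> w != 0 ->
  c v lam = c w lam.
Proof.
move=> l0 vl wl v0 w0.
have H (x y : row) : x *m lam = 0 -> y *m lam = 0 -> lin_indep2 x y ->
    c x lam = c y lam.
  move=> xl yl ind; apply: (indep_coef (q_indl ind l0 xl yl) (a := c (x + y) lam)).
  have x0 := lin_indep2_neq0 ind; have y0 := lin_indep2_neq0 (lin_indep2_sym ind).
  rewrite -(fbDl qb) // -!rE // ?rDl //; first exact: indep_add_neq0.
  by rewrite mulmxDl xl yl addr0.
have [ind|[k wk]] := lin_indep2P w v0; first exact: H.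
(* Proportional rows are compared through a row z independent of both. *)
have [z [zl ind]] := exists_indep_row n_gt1 l0 v0.
rewrite (H v z) //; apply/esym/H => //.
have [//|[a za]] := lin_indep2P z w0.
by have := lin_indep2_notin ind (a := a * k); rewrite za wk scalerA => /(_ erefl).
Qed.

Let constr v lam mu : v != 0 -> v *m lam = 0 -> v *m mu = 0 -> lam != 0 -> mu != 0 ->
  c v lam = c v mu.
Proof.
move=> v0 vl vm l0 m0.
have H (x y : col) : v *m x = 0 -> v *m y = 0 -> lin_indep2 x y -> c v x = c v y.
  move=> xl yl ind; apply: (indep_coef (q_indr ind v0 xl yl) (a := c v (x + y))).
  have x0 := lin_indep2_neq0 ind; have y0 := lin_indep2_neq0 (lin_indep2_sym ind).
  rewrite -(fbDr qb) // -!rE // ?rDr //; first exact: indep_add_neq0.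
  by rewrite mulmxDr xl yl addr0.
have [ind|[k wk]] := lin_indep2P mu l0; first exact: H.
have [z [zl ind]] : exists z : col, v *m z = 0 /\ lin_indep2 lam z.
  have vt0 : v^T != 0 by rewrite trmx_eq0.
  have lt0 : lam^T != 0 by rewrite trmx_eq0.
  have [z [zv ind]] := exists_indep_row n_gt1 vt0 lt0.
  exists z^T; split; first by rewrite -[v]trmxK -trmx_mul zv trmx0.
  by move=> a b /(congr1 trmx); rewrite linearP linearZ /= trmxK trmx0 => /ind.
rewrite (H lam z) //; apply/esym/H => //.
have [//|[a za]] := lin_indep2P z m0.
by have := lin_indep2_notin ind (a := a * k); rewrite za wk scalerA => /(_ erefl).
Qed.

Lemma proportional_const v lam w mu : v != 0 -> lam != 0 -> v *m lam = 0 ->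
  w != 0 -> mu != 0 -> w *m mu = 0 -> c v lam = c w mu.
Proof.
move=> v0 l0 vl w0 m0 wm; have [z [z0 zl zm]] := cap_hyp_neq0 n_gt1 l0 m0.
by rewrite (constl l0 vl zl) // (constr z0 zl zm) // (constl m0 zm wm).
Qed.

End Proportional.

(** The module with scalars acting through tau; a tau^-1-semilinear map on V is a
    linear map on [twist tau V]. *)
Definition twist (K : fieldType) (tau : {rmorphism K -> K}) (V : lmodType K) :
  Type := V.

Section Twist.
Variables (K : fieldType) (tau : {rmorphism K -> K}) (V : lmodType K).
Local Notation T := (twist tau V).

HB.instance Definition _ := GRing.Zmodule.on T.

Definition twist_scale (a : K) (x : T) : T := tau a *: (x : V).

Fact twist_scaleA a b x : twist_scale a (twist_scale b x) = twist_scale (a * b) x.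
Proof. by rewrite /twist_scale scalerA rmorphM. Qed.
Fact twist_scale1 : left_id 1 twist_scale.
Proof. by move=> x; rewrite /twist_scale rmorph1 scale1r. Qed.
Fact twist_scaleDr : right_distributive twist_scale +%R.
Proof. by move=> a x y; exact: scalerDr. Qed.
Fact twist_scaleDl x : {morph twist_scale^~ x : a b / a + b}.
Proof. by move=> a b; rewrite /twist_scale rmorphD; exact: scalerDl. Qed.

HB.instance Definition _ := GRing.Zmodule_isLmodule.Build K T
  twist_scaleA twist_scale1 twist_scaleDr twist_scaleDl.

Lemma twistE a (x : T) : a *: x = (tau a *: (x : V) : V).
Proof. by []. Qed.

End Twist.

Lemma inverse_rmorphism (K : fieldType) (s : {rmorphism K -> K}) : bijective s ->
  exists t : {rmorphism K -> K}, cancel s t /\ cancel t s.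
Proof.
move=> [t st ts].
have tB : {morph t : x y / x - y}.
  by move=> x y; apply: (can_inj st); rewrite rmorphB !ts.
have t1 : t 1 = 1 by apply: (can_inj st); rewrite ts rmorph1.
have tM : {morph t : x y / x * y}.
  by move=> x y; apply: (can_inj st); rewrite rmorphM !ts.
pose Ta := GRing.isZmodMorphism.Build K K t tB.
pose Tm := GRing.isMonoidMorphism.Build K K t (t1, tM).
by exists (HB.pack t Ta Tm : {rmorphism K -> K}).
Qed.

(** * Vectors of an embedding above rank one matrices *)

Section Lift.
Variables (n : nat) (K : fieldType).
Variables (Ahat : lmodType K) (ehat : gpoint (A1n n K) -> set Ahat).
Variables (sigma tau : {rmorphism K -> K}) (phi : Ahat -> adjoint n K).
Hypothesis ehat_emb : is_embedding ehat.
Hypothesis phi_proj : is_projection ehat (@eps_nat n K) sigma phi.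
Hypotheses (sigmaK : cancel sigma tau) (tauK : cancel tau sigma).
Implicit Types (v w : 'rV[K]_n.+1) (lam mu : 'cV[K]_n.+1) (x y z : flag n K).

Local Notation T := (twist tau Ahat).

(** The vector in the image of the flag (v, lam) that lies above lam *m v; it is 0
    if v or lam is 0. *)
Definition lift_vec v lam : T :=
  xget 0 [set a : Ahat |
    exists x, [/\ flag_rep x v lam, ehat x a & phi a = pure lam v]].

Let phiD (u w : Ahat) : phi (u + w) = phi u + phi w.
Proof. by have [[_ + _] _] := phi_proj; apply. Qed.

Let phiZ a (u : Ahat) : phi (a *: u) = sigma a *: phi u.
Proof. by have [[_ _ +] _] := phi_proj; apply. Qed.

Let phi_linear : linear (phi : T -> adjoint n K).
Proof. by move=> a u w; rewrite phiD; congr (_ + _); rewrite twistE phiZ tauK. Qed.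

Definition phi_lin : {linear T -> adjoint n K} :=
  HB.pack (phi : T -> adjoint n K)
    (GRing.isLinear.Build K T (adjoint n K) *:%R (phi : T -> adjoint n K) phi_linear).

Lemma lift_vecP x v lam : flag_rep x v lam ->
  [/\ ehat x (lift_vec v lam), phi (lift_vec v lam) = pure lam v
    & ehat x = ray (lift_vec v lam : Ahat)].
Proof.
move=> xr; have [_ pe] := phi_proj.
have [a [ya phia]] : exists a, ehat x a /\ phi a = pure lam v.
  have : eps_nat x (pure lam v) by rewrite (eps_natE xr); exact: ray_self.
  by rewrite pe => -[a xa ea]; exists a.
have [x' [xr' xu u_phi]] : exists x', [/\ flag_rep x' v lam,
    ehat x' (lift_vec v lam) & phi (lift_vec v lam) = pure lam v].
  by rewrite /lift_vec; case: xgetP => [b _ //|/(_ a) []]; exists x.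
rewrite (flag_rep_inj xr' xr) in xu; split=> //.
have [/(_ x)[b b0 xb] _ _ _] := ehat_emb; rewrite xb in xu *.
apply: ray_eq xu _; apply: contraTneq (pure_neq0 _ _ (flag_rep_orth xr)).
- by move=> u0; rewrite negbK -u_phi u0; apply/eqP/semilinear0; exact: phi_proj.1.
- by case: (flag_rep_neq0 xr).
- by case: (flag_rep_neq0 xr).
Qed.

Lemma lift_vec_unique x v lam (a : Ahat) : flag_rep x v lam ->
  ehat x a -> phi a = pure lam v -> a = lift_vec v lam.
Proof.
move=> xr; have [_ u_phi ->] := lift_vecP xr; move=> [b ->].
rewrite phiZ u_phi => e; have [v0 l0] := flag_rep_neq0 xr.
have p0 := pure_neq0 v0 l0 (flag_rep_orth xr).
suff -> : b = 1 by rewrite scale1r.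
apply: (can_inj sigmaK); rewrite rmorph1; apply/eqP; rewrite -subr_eq0.
have /eqP : (sigma b - 1) *: pure lam v = 0 by rewrite scalerBl scale1r e subrr.
by rewrite scaler_eq0 (negPf p0) orbF.
Qed.

Lemma lift_vec0 v lam : (v == 0) || (lam == 0) -> lift_vec v lam = 0.
Proof.
move=> vl0; rewrite /lift_vec; case: xgetP => // a _ [x [xr _ _]].
by have [v0 l0] := flag_rep_neq0 xr; rewrite (negPf v0) (negPf l0) in vl0.
Qed.

Lemma lift_vecZ a b x v lam : flag_rep x v lam -> a != 0 -> b != 0 ->
  lift_vec (a *: v) (b *: lam) = (a * b) *: lift_vec v lam.
Proof.
move=> xr a0 b0; have [xu u_phi xE] := lift_vecP xr; apply/esym.
apply: (@lift_vec_unique x); first exact: flag_repZ.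
  by rewrite xE; eexists; exact: twistE.
rewrite twistE phiZ tauK u_phi.
have vl := flag_rep_orth xr; have pb := @pure_bilinear n K.
rewrite -[RHS]/(pure_form _ _) (fbZl pb) ?(fbZr pb) ?scalerA //.
by rewrite -scalemxAr vl scaler0.
Qed.

(** The vector t lies in the plane spanned by u and w since the embedding sends
    lines onto lines, and phi is injective on this plane. *)
Lemma lift_add (l : set (flag n K)) x y z (u w t : Ahat) :
    gline (g := A1n n K) l -> l x -> l y -> l z -> ehat x u -> ehat y w -> ehat z t ->
    lin_indep2 (phi u) (phi w) -> phi t = phi u + phi w -> t = u + w.
Proof.
move=> lP lx ly lz xu yw zt ind e; have phi_semi := phi_proj.1.
have [_ _ /(_ l lP)[a [b [_ lE]]] _] := ehat_emb.
have sub x' (s : Ahat) : l x' -> ehat x' s -> lin_span [set a; b] s.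
  move=> lx' x's; have : (ehat @` l) (ehat x') by exists x'.
  by rewrite lE => -[_]; apply.
have uw := lin_indep2_image phi_semi ind.
have /lin_span2P[c [d tE]] :=
  lin_span2_exchange uw (sub _ _ lx xu) (sub _ _ ly yw) (sub _ _ lz zt).
have [|sc sd] := ind (sigma c - 1) (sigma d - 1).
  rewrite !scalerBl !scale1r addrACA -opprD -e tE phiD !phiZ.
  by rewrite subrr.
have one k : sigma k - 1 = 0 -> k = 1.
  by move=> /subr0_eq k1; apply: (can_inj sigmaK); rewrite k1 rmorph1.
by rewrite tE (one c) // (one d) // !scale1r.
Qed.

Lemma lift_vecDl v w lam : v *m lam = 0 -> w *m lam = 0 ->
  lift_vec (v + w) lam = lift_vec v lam + lift_vec w lam.
Proof.
move=> vl wl; have [->|l0] := eqVneq lam 0.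
  by rewrite !lift_vec0 ?addr0 // eqxx orbT.
have [->|v0] := eqVneq v 0; first by rewrite add0r (@lift_vec0 0) ?add0r // eqxx.
have [->|w0] := eqVneq w 0; first by rewrite addr0 (@lift_vec0 0) ?addr0 // eqxx.
have [x xr] := exists_flag v0 l0 vl; have [y yr] := exists_flag w0 l0 wl.
have [ind|[k wk]] := lin_indep2P w v0; last first.
  have k0 : k != 0 by apply: contraNneq w0 => k0; rewrite wk k0 scale0r.
  have Z c : c != 0 -> lift_vec (c *: v) lam = c *: lift_vec v lam.
    by move=> c0; rewrite -[lam in LHS]scale1r (lift_vecZ xr) ?oner_neq0 // mulr1.
  have -> : v + w = (1 + k) *: v by rewrite wk scalerDl scale1r.
  rewrite wk [lift_vec (k *: v) lam]Z //.
  have [k1|k1] := eqVneq (1 + k) 0; last by rewrite Z // scalerDl scale1r.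
  rewrite k1 scale0r lift_vec0 ?eqxx //.
  by rewrite -[X in X + _]scale1r -scalerDl k1 scale0r.
have vw0 := indep_add_neq0 ind.
have vwl : (v + w) *m lam = 0 by rewrite mulmxDl vl wl addr0.
have [z zr] := exists_flag vw0 l0 vwl.
have [xu ux _] := lift_vecP xr; have [yu uy _] := lift_vecP yr.
have [zu uz _] := lift_vecP zr.
apply: (@lift_add (point_range v w lam) x y z) => //.
- by right; apply/family2P; exists v, w, lam.
- by exists 1, 0; rewrite scale1r scale0r addr0.
- by exists 0, 1; rewrite scale1r scale0r add0r.
- by exists 1, 1; rewrite !scale1r.
- by rewrite ux uy; exact: pure_indep_rows.
- by rewrite ux uy uz; apply: (fbDl (@pure_bilinear n K)).
Qed.

Lemma lift_vecDr v lam mu : v *m lam = 0 -> v *m mu = 0 ->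
  lift_vec v (lam + mu) = lift_vec v lam + lift_vec v mu.
Proof.
move=> vl vm; have [->|v0] := eqVneq v 0; first by rewrite !lift_vec0 ?addr0 // eqxx.
have [->|l0] := eqVneq lam 0.
  by rewrite add0r (@lift_vec0 _ 0) ?add0r // eqxx orbT.
have [->|m0] := eqVneq mu 0.
  by rewrite addr0 (@lift_vec0 _ 0) ?addr0 // eqxx orbT.
have [x xr] := exists_flag v0 l0 vl; have [y yr] := exists_flag v0 m0 vm.
have [ind|[k mk]] := lin_indep2P mu l0; last first.
  have k0 : k != 0 by apply: contraNneq m0 => k0; rewrite mk k0 scale0r.
  have Z c : c != 0 -> lift_vec v (c *: lam) = c *: lift_vec v lam.
    by move=> c0; rewrite -[v in LHS]scale1r (lift_vecZ xr) ?oner_neq0 // mul1r.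
  have -> : lam + mu = (1 + k) *: lam by rewrite mk scalerDl scale1r.
  rewrite mk [lift_vec v (k *: lam)]Z //.
  have [k1|k1] := eqVneq (1 + k) 0; last by rewrite Z // scalerDl scale1r.
  rewrite k1 scale0r lift_vec0 ?eqxx ?orbT //.
  by rewrite -[X in X + _]scale1r -scalerDl k1 scale0r.
have lm0 := indep_add_neq0 ind.
have vlm : v *m (lam + mu) = 0 by rewrite mulmxDr vl vm addr0.
have [z zr] := exists_flag v0 lm0 vlm.
have [xu ux _] := lift_vecP xr; have [yu uy _] := lift_vecP yr.
have [zu uz _] := lift_vecP zr.
apply: (@lift_add (hyp_pencil v lam mu) x y z) => //.
- by left; apply/family1P; exists v, lam, mu.
- by exists 1, 0; rewrite scale1r scale0r addr0.
- by exists 0, 1; rewrite scale1r scale0r add0r.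
- by exists 1, 1; rewrite !scale1r.
- by rewrite ux uy; exact: pure_indep_cols.
- by rewrite ux uy uz; apply: (fbDr (@pure_bilinear n K)).
Qed.

Lemma lift_vec_scale a v lam : v *m lam = 0 ->
  lift_vec (a *: v) lam = a *: lift_vec v lam /\
  lift_vec v (a *: lam) = a *: lift_vec v lam.
Proof.
move=> vl; have [->|v0] := eqVneq v 0.
  by rewrite scaler0 !lift_vec0 ?scaler0 // eqxx.
have [->|l0] := eqVneq lam 0.
  by rewrite scaler0 !lift_vec0 ?scaler0 // eqxx orbT.
have [->|a0] := eqVneq a 0; first by rewrite !scale0r !lift_vec0 // eqxx ?orbT.
have [x xr] := exists_flag v0 l0 vl; split.
  by rewrite -[lam in LHS]scale1r (lift_vecZ xr) ?oner_neq0 // mulr1.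
by rewrite -[v in LHS]scale1r (lift_vecZ xr) ?oner_neq0 // mul1r.
Qed.

Lemma lift_vec_bilinear : flag_bilinear lift_vec.
Proof.
split=> [lam a v w vl wl|v a lam mu vl vm].
  rewrite lift_vecDl // -?scalemxAl ?vl ?scaler0 //.
  by rewrite (lift_vec_scale a vl).1.
rewrite lift_vecDr // -?scalemxAr ?vl ?scaler0 //.
by rewrite (lift_vec_scale a vl).2.
Qed.

Lemma phi_linE v lam : v *m lam = 0 -> phi_lin (lift_vec v lam) = pure lam v.
Proof.
move=> vl; have [->|v0] := eqVneq v 0.
  rewrite lift_vec0 ?eqxx // linear0 -[RHS]/(pure_form _ _).
  by rewrite (fb0l (@pure_bilinear n K)).
have [->|l0] := eqVneq lam 0.
  rewrite lift_vec0 ?eqxx ?orbT // linear0 -[RHS]/(pure_form _ _).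
  by rewrite (fb0r (@pure_bilinear n K)).
have [x xr] := exists_flag v0 l0 vl.
by have [_ u_phi _] := lift_vecP xr; exact: u_phi.
Qed.

Lemma lift_vec_span (N : set T) : lin_closed N ->
  (forall v lam, v *m lam = 0 -> N (lift_vec v lam)) -> forall a, N a.
Proof.
move=> cN Nu a; have [_ _ _ span] := ehat_emb.
have : lin_span (\bigcup_(x in setT) ehat x) a by rewrite span.
apply: (@lin_span_min K Ahat _ N).
  split=> [|k b c Nb Nc]; first exact: cN.1.
  by have := cN.2 (sigma k) _ _ Nb Nc; rewrite twistE sigmaK.
move=> b [x _ xb]; have [v [lam xr]] := exists_flag_rep x.
have [_ _ xE] := lift_vecP xr; move: xb; rewrite xE => -[k ->].
have := lin_closedZ (sigma k) cN (Nu _ _ (flag_rep_orth xr)).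
by rewrite twistE sigmaK.
Qed.

Lemma lift_vec_act (act : Ahat -> SL n K -> Ahat) (g : SL n K) v lam :
  is_lift ehat phi act -> v *m lam = 0 ->
  act (lift_vec v lam) g = lift_vec (v *m g) (invmx g *m lam).
Proof.
move=> [[act_lin _ _] phi_act ehat_act] vl.
have act0 : act 0 g = 0.
  by have := act_lin g (-1) 0 0; rewrite scaleN1r oppr0 addr0 scaleN1r addNr.
have [->|v0] := eqVneq v 0; first by rewrite mul0mx !lift_vec0 ?eqxx.
have [->|l0] := eqVneq lam 0; first by rewrite mulmx0 !lift_vec0 ?eqxx ?orbT.
have [x xr] := exists_flag v0 l0 vl; have [xu u_phi _] := lift_vecP xr.
apply: (lift_vec_unique (flag_rep_act g xr)).
  by rewrite ehat_act; exists (lift_vec v lam).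
apply: val_inj; rewrite phi_act u_phi /= !pureE ?mulmxA ?mulmxK ?SL_unitmx //.
Qed.

End Lift.

(** * One embedding and one linear form for each derivation *)

Section DerivationEmbedding.
Variables (n : nat) (K : fieldType) (n_gt1 : (1 < n)%N).
Variables (d : K -> K) (dd : is_derivation d).

Definition der_vec (v : 'rV[K]_n.+1) (lam : 'cV[K]_n.+1) : (K^o * adjoint n K)%type :=
  (der_form d v lam, pure lam v).

Lemma der_vec_bilinear : flag_bilinear der_vec.
Proof.
have db := @der_form_bilinear n K d dd; have pb := @pure_bilinear n K.
split=> [lam a v w vl wl|v a lam mu vl vm]; apply/pair_equal_spec.
  by split; [exact: db.1|exact: pb.1].
by split; [exact: db.2|exact: pb.2].
Qed.

(** The frame spans the copy of the adjoint module, and the derivation extracted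
    from der_vec takes the values (d x, 0); one nonzero value is enough. *)
Lemma der_vec_span (N : set (K^o * adjoint n K)%type) x0 : d x0 != 0 ->
  lin_closed N -> (forall v lam, v *m lam = 0 -> N (der_vec v lam)) -> forall z, N z.
Proof.
move=> dx0 cN Nq [k a]; have qb := der_vec_bilinear.
have db := @der_form_bilinear n K d dd; have pb := @pure_bilinear n K.
have fm : frame_map der_vec a = (0, a).
  rewrite [LHS]surjective_pairing; congr pair.
    rewrite -[LHS]/(fst (frame_map der_vec a)) (frame_map_image (F := fst) qb db) //.
    exact: frame_der_form.
  rewrite -[LHS]/(snd (frame_map der_vec a)) (frame_map_image (F := snd) qb pb) //.
  exact: frame_pure.
have fd : frame_der der_vec x0 = (d x0, 0).
  rewrite [LHS]surjective_pairing; congr pair.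
    rewrite -[LHS]/(fst (frame_der der_vec x0)) (frame_der_image (F := fst) qb db) //.
    exact: frame_der_der_form.
  rewrite -[LHS]/(snd (frame_der der_vec x0)) (frame_der_image (F := snd) qb pb) //.
  exact: frame_der_pure.
have -> : (k, a) = (k / d x0) *: frame_der der_vec x0 + frame_map der_vec a.
  rewrite fm fd; apply/pair_equal_spec; split=> /=; last by rewrite scaler0 add0r.
  by rewrite addr0 -[RHS]/(_ * _) divfK.
by apply: cN.2; [exact: frame_der_closed|exact: frame_map_closed].
Qed.

Lemma der_vec_embedding x0 : d x0 != 0 -> @is_embedding K (A1n n K) _ (vec_map der_vec).
Proof.
move=> dx0; apply: (@vec_map_embedding _ _ _ _ snd der_vec_bilinear) => // N.
exact: der_vec_span dx0.
Qed.

End DerivationEmbedding.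

Section DerivationFunctional.
Variables (n : nat) (K : fieldType) (n_gt1 : (1 < n)%N).
Variables (Ahat : lmodType K) (ehat : gpoint (A1n n K) -> set Ahat).
Variables (sigma tau : {rmorphism K -> K}) (phi : Ahat -> adjoint n K).
Hypothesis ehat_univ : is_rel_universal_cover ehat (@eps_nat n K).
Hypothesis phi_proj : is_projection ehat (@eps_nat n K) sigma phi.
Hypotheses (sigmaK : cancel sigma tau) (tauK : cancel tau sigma).

Local Notation T := (twist tau Ahat).
Let lv : 'rV[K]_n.+1 -> 'cV[K]_n.+1 -> T := lift_vec ehat tau phi.

(** If d is not 0, der_vec d gives an embedding that covers the natural one, so
    ehat covers it through a semilinear map psi. The vectors psi (lv v lam) and
    der_vec d v lam are proportional; the factor k is constant, which makes the
    field automorphism of psi the inverse of tau, and the first coordinate of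
    k^-1 psi is the form sought. *)
Lemma exists_der_functional (d : K -> K) : is_derivation d ->
  exists l : {linear T -> K^o},
    forall v lam, v *m lam = 0 -> l (lv v lam) = der_form d v lam.
Proof.
move=> dd; have [ehat_emb _ univ] := ehat_univ.
have lb : flag_bilinear lv := lift_vec_bilinear ehat_emb phi_proj sigmaK tauK.
have [d0|/existsNP[x0 /eqP dx0]] := pselect (forall x, d x = 0).
  exists (\0 : {linear T -> K^o}) => v lam _; rewrite /der_form.
  rewrite (_ : map_mx d lam = 0) ?mulmx0 ?mxE //.
  by apply/matrixP=> i j; rewrite !mxE d0.
pose q := @der_vec n K d; have qb : flag_bilinear q := der_vec_bilinear n dd.
have [|psi_s [psi [psi_semi psi_e]]] := univ _ _ (der_vec_embedding n_gt1 dd dx0).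
  exists idfun, snd; apply: (vec_map_projection (pi := snd) qb).
  by [].
have [_ psiD psiZ] := psi_semi.
have rDl v w lam : v *m lam = 0 -> w *m lam = 0 ->
    psi (lv (v + w) lam) = psi (lv v lam) + psi (lv w lam).
  by move=> vl wl; rewrite (fbDl lb) // psiD.
have rDr v lam mu : v *m lam = 0 -> v *m mu = 0 ->
    psi (lv v (lam + mu)) = psi (lv v lam) + psi (lv v mu).
  by move=> vl vm; rewrite (fbDr lb) // psiD.
have psi_ray x v lam : flag_rep x v lam -> ray (q v lam) = ray (psi (lv v lam)).
  move=> xr; rewrite -(vec_mapE qb xr) psi_e.
  by have [_ _ ->] := lift_vecP tau ehat_emb phi_proj xr; exact: image_ray psi_semi.
have /choice[c cE] : forall p : 'rV[K]_n.+1 * 'cV[K]_n.+1, exists c : K,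
    p.1 != 0 -> p.2 != 0 -> p.1 *m p.2 = 0 -> psi (lv p.1 p.2) = c *: q p.1 p.2.
  move=> [v lam] /=.
  have [[v0 l0 vl]|H] := pselect [/\ v != 0, lam != 0 & v *m lam = 0].
    have [x xr] := exists_flag v0 l0 vl.
    have : ray (q v lam) (psi (lv v lam)).
      by rewrite (psi_ray _ _ _ xr); exact: ray_self.
    by move=> [c cE]; exists c.
  by exists 0 => ? ? ?; case: H.
have e0 : er K (0 : 'I_n.+1) != 0.
  by apply/eqP => /rowP/(_ 0); rewrite !mxE !eqxx => /eqP; rewrite oner_eq0.
have f0 : fc K (ord_max : 'I_n.+1) != 0.
  by apply/eqP => /colP/(_ ord_max); rewrite !mxE !eqxx => /eqP; rewrite oner_eq0.
have ef : er K (0 : 'I_n.+1) *m fc K ord_max = 0.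
  by rewrite er_fc -val_eqE /= eq_sym -leqn0 leqNgt ltnW.
pose k := c (er K 0, fc K ord_max).
have rE v lam : v *m lam = 0 -> psi (lv v lam) = k *: q v lam.
  move=> vl; have psi0 := semilinear0 psi_semi.
  have [->|v0] := eqVneq v 0; first by rewrite (fb0l lb) (fb0l qb) psi0 scaler0.
  have [->|l0] := eqVneq lam 0; first by rewrite (fb0r lb) (fb0r qb) psi0 scaler0.
  rewrite (cE (v, lam)) //; congr (_ *: _).
  apply: (@proportional_const n K n_gt1 _ q (fun v lam => psi (lv v lam)) qb rDl rDr
    _ _ (fun v lam => c (v, lam))) => //.
  - move=> u w mu ind m0 um wm; apply: (@lin_indep2_lift _ _ _ snd).
    exact: pure_indep_rows.
  - move=> u mu nu ind u0 um un; apply: (@lin_indep2_lift _ _ _ snd).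
    exact: pure_indep_cols.
  - by move=> u mu *; rewrite (cE (u, mu)).
have [x xr] := exists_flag e0 f0 ef.
have q0 : q (er K 0) (fc K ord_max) != 0 by apply: (q_neq0 (pi := snd)) xr.
have k0 : k != 0.
  apply/eqP => k0; have := ray_self (q (er K 0) (fc K ord_max)).
  rewrite (psi_ray _ _ _ xr) rE // k0 scale0r => -[a]; rewrite scaler0.
  exact/eqP.
have psi_sE a : psi_s (tau a) = a.
  have := rE (a *: er K 0) (fc K ord_max).
  rewrite -scalemxAl ef scaler0 => /(_ erefl).
  rewrite (fbZl lb) // twistE psiZ rE // (fbZl qb) // !scalerA => /eqP.
  rewrite -subr_eq0 -scalerBl scaler_eq0 (negPf q0) orbF subr_eq0 => /eqP.
  by rewrite mulrC => /(mulfI k0).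
pose l (w : T) : K^o := k^-1 * (psi w).1.
have l_lin : linear l.
  move=> a u w; rewrite /l psiD twistE psiZ psi_sE /= mulrDr.
  by rewrite -[_ *: (psi u).1]/(_ * _) -[X in _ = X + _]/(_ * _) mulrCA.
exists (HB.pack l (GRing.isLinear.Build K T K^o *:%R l l_lin) : {linear T -> K^o}).
move=> v lam vl; rewrite /= /l rE //=.
by rewrite -[_ *: (q v lam).1]/(_ * _) mulKf.
Qed.

End DerivationFunctional.

(** * The isomorphism and the pivot *)

(** Since G permutes the values of ehat, any flag and any two lines through it,
    one of each family, together with their images, recover ehat itself. *)
Lemma exists_pivot (n : nat) (K : fieldType) (Ahat : lmodType K)
    (ehat : gpoint (A1n n K) -> set Ahat) (sigma : {rmorphism K -> K})
    (phi : Ahat -> adjoint n K) (act : Ahat -> SL n K -> Ahat) :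
  (1 < n)%N -> is_embedding ehat ->
  is_projection ehat (@eps_nat n K) sigma phi -> is_lift ehat phi act ->
  exists P : pivot n Ahat, is_pivot phi P /\ pivot_embedding act P ehat.
Proof.
move=> n_gt1 [pt inj line _] [_ phiE] [_ _ ehat_act].
have [k /andP[kmax k0]] := exists_third n_gt1 ord_max 0.
have max0 := ord_max_neq0 n_gt1.
pose e i := er K (i : 'I_n.+1); pose f i := fc K (i : 'I_n.+1).
have e_neq0 i : e i != 0.
  by apply/eqP => /rowP/(_ i); rewrite !mxE !eqxx => /eqP; rewrite oner_eq0.
have f_neq0 i : f i != 0.
  by apply/eqP => /colP/(_ i); rewrite !mxE !eqxx => /eqP; rewrite oner_eq0.
have ef i j : i != j -> e i *m f j = 0 by move=> ij; rewrite er_fc (negPf ij).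
have ind_e : lin_indep2 (e 0) (e k).
  move=> a b /rowP ab; have := ab 0; have := ab k.
  rewrite !mxE !eqxx (negPf k0) eq_sym (negPf k0) /=.
  by rewrite !mulr0 !mulr1 add0r addr0.
have ind_f : lin_indep2 (f ord_max) (f k).
  move=> a b /colP ab; have := ab ord_max; have := ab k.
  rewrite !mxE !eqxx (negPf kmax) eq_sym (negPf kmax) /=.
  by rewrite !mulr0 !mulr1 add0r addr0.
have max0' : 0 != ord_max :> 'I_n.+1 by rewrite eq_sym.
have k0' : 0 != k by rewrite eq_sym.
have [x xr] := exists_flag (e_neq0 0) (f_neq0 ord_max) (ef _ _ max0').
pose l := hyp_pencil (e 0) (f ord_max) (f k).
pose l' := point_range (e 0) (e k) (f ord_max).
have lP : family1 l.
  by apply/family1P; exists (e 0), (f ord_max), (f k); split=> //; exact: ef.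
have lP' : family2 l'.
  by apply/family2P; exists (e 0), (e k), (f ord_max); split=> //; exact: ef.
have lx : l x by exists 1, 0; rewrite scale1r scale0r addr0.
have lx' : l' x by exists 1, 0; rewrite scale1r scale0r addr0.
have im_phi (m : set (flag n K)) :
    [set phi @` Q | Q in ehat @` m] = @eps_nat n K @` m.
  by rewrite image_comp; apply: eq_imagel => y _ /=; rewrite phiE.
have im_act (m : set (flag n K)) g :
    ehat @` [set flag_act y g | y in m] = [set act^~ g @` Q | Q in ehat @` m].
  by rewrite !image_comp; apply: eq_imagel => y _ /=; rewrite ehat_act.
exists (Pivot x l l' (ehat x) (ehat @` l) (ehat @` l')); split=> [|g] /=; last first.
  by split; [exact: ehat_act|exact: im_act|exact: im_act].
split=> //=.
split; [exact: pt| |by exists x| |by exists x].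
  by apply: line; left.
by apply: line; right.
Qed.

Theorem theorem1p2 (n : nat) (K : fieldType) (Omega : set K)
    (Ahat : lmodType K) (ehat : gpoint (A1n n K) -> set Ahat)
    (sigma : {rmorphism K -> K}) (phi : Ahat -> adjoint n K)
    (act : Ahat -> SL n K -> Ahat) :
  (2 <= n)%N ->
  is_derivation_basis Omega ->
  is_rel_universal_cover ehat (@eps_nat n K) ->
  is_projection ehat (@eps_nat n K) sigma phi ->
  is_lift ehat phi act ->
  exists f : Ahat -> MA n Omega,
    [/\ bijective f,
        is_semilinear sigma f,
        (forall u g, f (act u g) = MA_act (f u) g)
      & exists (P : pivot n Ahat) (e : gpoint (A1n n K) -> set Ahat)
               (beta : Ahat -> Ahat),
        [/\ is_pivot phi P,
            pivot_embedding act P e,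
            is_collineation beta,
            (forall x, e x = beta @` ehat x)
          & forall (x : flag n K) (v : 'rV[K]_n.+1) (lam : 'cV[K]_n.+1),
              represents_point v (fpt x) -> represents_hyp lam (fhyp x) ->
              f @` e x = ray (MA_vec Omega v lam)]].
Proof.
move=> n_gt1 OmegaP ehat_univ phi_proj act_lift.
have [ehat_emb _ _] := ehat_univ.
have [[sigma_bij _ _] _] := phi_proj.
have [tau [sigmaK tauK]] := inverse_rmorphism sigma_bij.
pose u := lift_vec ehat tau phi.
have ub : flag_bilinear u := lift_vec_bilinear ehat_emb phi_proj sigmaK tauK.
have u_span := @lift_vec_span _ _ _ _ _ _ _ ehat_emb phi_proj sigmaK.
pose phi_l := phi_lin phi_proj tauK.
have phi_lE v lam : v *m lam = 0 -> phi_l (u v lam) = pure lam v.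
  exact: phi_linE.
have /choice[ell ellE] : forall w, exists l : {linear twist tau Ahat -> K^o},
    forall v lam, v *m lam = 0 -> l (u v lam) = der_form (der_at Omega w) v lam.
  move=> w; have [dw _] := der_atP OmegaP w.
  exact: (exists_der_functional n_gt1 ehat_univ phi_proj sigmaK tauK dw).
pose f : Ahat -> MA n Omega := model_map Omega phi_l ell.
have f_lin : linear (f : twist tau Ahat -> MA n Omega).
  exact: (model_map_linear n_gt1 OmegaP ub u_span phi_lE ellE).
have f_inj : injective f := model_map_inj n_gt1 OmegaP ub u_span phi_lE ellE.
have f_semi : is_semilinear sigma f.
  split=> // [a b|k a].
    by have := f_lin 1 a b; rewrite !scale1r.
  have f0 : f 0 = 0.
    by have := f_lin (-1) 0 0; rewrite !scaleN1r oppr0 addr0 addNr.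
  by have := f_lin (sigma k) a 0; rewrite twistE sigmaK f0 !addr0.
have [P [P_pivot P_emb]] := exists_pivot n_gt1 ehat_emb phi_proj act_lift.
exists f; split=> //.
- have /choice[h hE] := model_map_surj n_gt1 OmegaP ub u_span phi_lE ellE.
  by exists h => a //; apply: f_inj; rewrite [LHS]hE.
- apply: (model_map_act n_gt1 OmegaP ub u_span phi_lE ellE) => [g k a b|g v lam vl].
    by have [[+ _ _] _ _] := act_lift; apply.
  exact: (lift_vec_act ehat_emb phi_proj).
exists P, ehat, id; split=> // [|x|x v lam xv xl].
- split; first by exists id.
  by exists idfun; split=> //; exists id.
- by rewrite image_id.
have xr : flag_rep x v lam by [].
have [_ _ ->] := lift_vecP tau ehat_emb phi_proj xr.
rewrite (image_ray _ f_semi); congr ray.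
by apply: model_map_u; [exact: phi_lE|exact: ellE|exact: flag_rep_orth xr].
Qed.
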